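(* Let $\rho_u>0$, $\mu_1,\dots,\mu_m>0$, let $X_K$ be a finite-dimensional subspace of $H^1_0(\Omega)$ with $L_2(\Omega)$-orthonormal basis $\{\phi_1,\dots,\phi_{n_K}\}$, and let $\mathcal{T}_\theta^K$, $\mathbf{F}_K(\tau)$ and $\theta_{ro}$ be as in the context. Put $\mathcal{J}_K(u)=\|\mathcal{T}_\theta^K[u]-\theta_{ro}\|^2_{L_2(\Omega)}+\rho_u\|u\|^2_{L_2(0,t_F)^m}$, let $u_b=(\mu_1,\dots,\mu_m)^{\mathrm T}$ and $u_a=-u_b$ (constant functions of $t$), and for $\lambda=(\lambda_a,\lambda_b)$ with $\lambda_a,\lambda_b\in L_2(0,t_F)^m$ define $$Lag_K(u,\lambda)=\mathcal{J}_K(u)+2\langle\lambda_a,u_a-u\rangle_{L_2(0,t_F)^m}+2\langle\lambda_b,u-u_b\rangle_{L_2(0,t_F)^m}.$$ Then for every such $\lambda$ the problem of minimizing $Lag_K(u,\lambda)$ over $u\in L_2(0,t_F)^m$ has a unique solution $u_c^K[\lambda]$, given by $$u_c^K[\lambda](\tau)=u_K(\tau)-\mathbf{F}_K(\tau)\big(\rho_u^{-1}\mathbf{I}-(\rho_u\mathbf{I}+\mathbf{G}_K)^{-1}\big)\bar\alpha_\lambda^K+\rho_u^{-1}(\lambda_a(\tau)-\lambda_b(\tau)),$$ where $\mathbf{G}_K=\int_0^{t_F}\mathbf{F}_K(\tau)^{\mathrm T}\mathbf{F}_K(\tau)d\tau$, $u_K(\tau)=\mathbf{F}_K(\tau)(\rho_u\mathbf{I}+\mathbf{G}_K)^{-1}\bar\theta_{ro}^K$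 with $\bar\theta_{ro}^K=[\langle\phi_1,\theta_{ro}\rangle\ \cdots\ \langle\phi_{n_K},\theta_{ro}\rangle]^{\mathrm T}$, $\xi_\lambda^K=\int_0^{t_F}\mathbf{F}_K(\tau)^{\mathrm T}(\lambda_a(\tau)-\lambda_b(\tau))d\tau$, and $\bar\alpha_\lambda^K\in\mathbb{R}^{n_K}$ denotes a solution of the linear system $\mathbf{G}_K\bar\alpha_\lambda^K=\xi_\lambda^K$.
   Context: $\Omega\subset\mathbb{R}^d$ is a bounded, open, connected set, $t_F>0$, $m$ is a positive integer, $\langle\cdot,\cdot\rangle$ (without subscript) is the inner product of $L_2(\Omega)$. Coefficients $a^{ij}=a^{ji},b^i,c\in L_\infty(\Omega)$ are given and $$\mathbf{B}[u,v]=\int_\Omega\Big\{\sum_{i,j=1}^d a^{ij}u_{x_i}v_{x_j}+\sum_{i=1}^d b^iu_{x_i}v+cuv\Big\}dx,\qquad u,v\in H^1_0(\Omega).$$ $\mathbf{B}$ satisfies Gårding's inequality: there are $\kappa\ge0$, $\kappa_0>0$ with $\mathbf{B}[\phi,\phi]+\kappa\|\phi\|^2_{L_2(\Omega)}\ge\kappa_0\|\phi\|^2_{H^1_0(\Omega)}$ for all $\phi\in H^1_0(\Omega)$. The operator $A$ on $L_2(\Omega)$ is defined by $\langle -A[\phi],\psi\rangle=\mathbf{B}[\phi,\psi]$ for all $\psi\in H^1_0(\Omega)$, with $\operatorname{dom}(A)$ the set of $\phi\in H^1_0(\Omega)$ for which $\mathbf{B}[\phi,\cdot]$ is represented by an element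 of $L_2(\Omega)$; $A$ generates a $C_0$-semigroup $S_A(t)$ on $L_2(\Omega)$. For $f\in L_2(\Omega\times(0,t_F))$ and $g\in L_2(\Omega)$, $\underline\theta(t;f,g)=S_A(t)[g]+\int_0^tS_A(t-\tau)[f(\cdot,\tau)]d\tau$. Data: $\beta_{S1},\dots,\beta_{Sm}\in L_2(\Omega)$, $f_S\in L_2(\Omega\times(0,t_F))$, $g,\theta_r\in L_2(\Omega)$; $\theta_{ro}=\theta_r-\underline\theta(t_F;f_S,g)\in L_2(\Omega)$. Finite-dimensional objects: $\mathcal{A}_K:X_K\to X_K$ is the linear operator with $\langle\mathcal{A}_K[\phi],\psi\rangle=-\mathbf{B}[\phi,\psi]$ for all $\phi,\psi\in X_K$; $\mathbf{A}_K\in\mathbb{R}^{n_K\times n_K}$ is its matrix in the basis $\{\phi_1,\dots,\phi_{n_K}\}$, i.e. $\{\mathbf{A}_K\}_{k\ell}=-\mathbf{B}[\phi_\ell,\phi_k]$; $S_K(t)=\sum_{\ell\ge0}\mathcal{A}_K^\ell t^\ell/\ell!$; $P_K$ is the orthogonal projection of $L_2(\Omega)$ onto $X_K$; and $$\mathcal{T}_\theta^K[u]=\int_0^{t_F}S_K(t_F-\tau)\Big[P_K\Big[\sum_{i=1}^m\beta_{Si}u_i(\tau)\Big]\Big]d\tau .$$ $\mathbf{M}_\beta^K\in\mathbb{R}^{n_K\times m}$ has entries $\{\mathbf{M}_\beta^K\}_{ki}=\langle\beta_{Si},\phi_k\rangle$ and $\mathbf{F}_K(\tau)=(\mathbf{M}_\beta^K)^{\mathrm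 T}\exp[\mathbf{A}_K^{\mathrm T}(t_F-\tau)]\in\mathbb{R}^{m\times n_K}$. *)

(* Defs.v *)
From HB Require Import structures.
From mathcomp Require Import all_boot all_order all_algebra.
From mathcomp Require Import all_classical all_reals all_analysis.
Set Implicit Arguments.
Unset Strict Implicit.
Unset Printing Implicit Defensive.
Import Order.TTheory GRing.Theory Num.Theory.
Import numFieldNormedType.Exports.
Local Open Scope classical_set_scope.
Local Open Scope ring_scope.

(* 'rV[R]_n carries its Borel sigma-algebra. *)
HB.instance Definition _ (R : realType) (n : nat) :=
  Measurable.copy 'rV[R]_n (g_sigma_algebraType (@open 'rV[R]_n)).

Section lebesgue_rV.
Context {R : realType}.

Lemma open_measurable_rV n (U : set 'rV[R]_n) : open U -> measurable U.
Proof. exact: sub_sigma_algebra. Qed.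

Definition rV_cons n (p : measurableTypeR R * 'rV[R]_n) : 'rV[R]_n.+1 :=
  \row_i (if unlift ord0 i is Some j then p.2 ord0 j else p.1).

Definition rV_uncons n (v : 'rV[R]_n.+1) : measurableTypeR R * 'rV[R]_n :=
  (v ord0 ord0, \row_j v ord0 (lift ord0 j)).

Lemma rV_unconsK n : cancel (@rV_uncons n) (@rV_cons n).
Proof.
move=> v; apply/rowP => i; rewrite mxE.
by case: unliftP => [j|] -> //=; rewrite mxE.
Qed.

Lemma rV_consK n : cancel (@rV_cons n) (@rV_uncons n).
Proof.
move=> [x v]; rewrite /rV_uncons mxE unlift_none; congr pair.
by apply/rowP => i; rewrite !mxE liftK.
Qed.

Lemma rV_cons_ball n (p q : measurableTypeR R * 'rV[R]_n) (e : R) :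
  ball p.1 e q.1 -> ball p.2 e q.2 -> ball (rV_cons p) e (rV_cons q).
Proof.
move=> b1 b2; have e0 : 0 < e := le_lt_trans (normr_ge0 _) b1.
split => // i j; rewrite !mxE.
by case: unliftP => [k|] _ //; case: b2 => _; exact.
Qed.

Lemma measurable_rV_cons n : measurable_fun setT (@rV_cons n).
Proof.
apply: (measurability (@open 'rV[R]_n.+1)) => //.
move=> _ [U oU <-]; rewrite setTI.
pose V := @rV_cons n @^-1` U.
pose box (t : rat * 'rV[rat]_n * rat) : set (measurableTypeR R * 'rV[R]_n) :=
  ball (ratr t.1.1 : R) (ratr t.2) `*` ball (map_mx ratr t.1.2 : 'rV[R]_n) (ratr t.2).
pose D := [set t | box t `<=` V].
suff -> : @rV_cons n @^-1` U = \bigcup_(t in D) box t.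
  rewrite bigcup_mkcond; apply: countable_bigcupT_measurable => [|t]; first exact: countableP.
  case: ifPn => // _; apply: measurableX.
    by rewrite ball_itv; exact: measurable_itv.
  by apply: open_measurable_rV; exact: ball_open.
apply/seteqP; split => [p|p [t Dt /Dt //]].
move=> Up; have /nbhs_ballP[e /= e0 eU] : nbhs (rV_cons p) U.
  exact: open_nbhs_nbhs.
have [r /[!in_itv]/= /andP[r0 re]] : exists r, ratr r \in `]0, e / 2[.
  by apply: rat_in_itvoo; rewrite divr_gt0.
have app (x : R) : exists q : rat, `|ratr q - x| < ratr r.
  have [q /[!in_itv]/= qx] : exists q, ratr q \in `](x - ratr r), (x + ratr r)[.
    by apply: rat_in_itvoo; rewrite ltrD2l gtrN.
  by exists q; rewrite ltr_distl.
have [q qx] := app p.1.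
have /choice[w wx] := fun i => app (p.2 ord0 i).
exists (q, \row_i w i, r); last first.
  split => //=; split => // i j; rewrite !mxE (ord1 i); exact: wx.
move=> p' /= [b1 b2]; apply: eU.
have rre : ratr r + ratr r < e by rewrite [ltRHS]splitr ltrD.
apply: (@le_ball _ _ _ (ratr r + ratr r)); first exact: ltW.
apply: rV_cons_ball.
  by apply: (ball_triangle _ b1); exact: ball_sym.
apply: (ball_triangle _ b2); apply: ball_sym.
by split => // i j; rewrite !mxE (ord1 i); exact: wx.
Qed.

Lemma measurable_rV_coord n (i : 'I_n) :
  measurable_fun setT (fun v : 'rV[R]_n => v ord0 i : measurableTypeR R).
Proof.
apply: (measurability (@measurable_realfun.RGenOpens.G R)).
  exact: measurable_realfun.RGenOpens.measurableE.
move=> _ [_ [x [y ->]] <-]; rewrite setTI; apply: open_measurable_rV.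
apply: open_comp; last exact: interval_open.
by move=> v _; exact: coord_continuous.
Qed.

Lemma measurable_rV_uncons n : measurable_fun setT (@rV_uncons n).
Proof.
apply: measurable_fun_pair; first exact: measurable_rV_coord.
apply: (measurability (@open 'rV[R]_n)) => //.
move=> _ [U oU <-]; rewrite setTI; apply: open_measurable_rV.
apply: open_comp => // v _.
move=> A /nbhs_ballP[e e0 eA]; apply/nbhs_ballP; exists e => //= w [_ vw].
by apply: eA; split => // i j; rewrite !mxE; exact: vw.
Qed.

Section cons_measure.
Variables (n : nat) (m : {sigma_finite_measure set 'rV[R]_n -> \bar R}).

Definition rV_cons_measure : set 'rV[R]_n.+1 -> \bar R :=
  pushforward (@lebesgue_measure R \x m)%E (@rV_cons n).

HB.instance Definition _ := Measure.copy rV_cons_measure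
  (measure_function_pushforward__canonical__measure_function_Measure
     (@lebesgue_measure R \x m)%E (@measurable_rV_cons n)).

Lemma rV_cons_measure_sigma_finite : sigma_finite setT rV_cons_measure.
Proof.
have /sigma_finiteP[F [FT ndF Foo]] := sigma_finiteT (@lebesgue_measure R).
have /sigma_finiteP[G [GT ndG Goo]] := sigma_finiteT m.
exists (fun k => @rV_uncons n @^-1` (F k `*` G k)).
  apply/seteqP; split => // v _.
  have [j _ Fj] : (\bigcup_i F i) (rV_uncons v).1 by rewrite -FT.
  have [k _ Gk] : (\bigcup_i G i) (rV_uncons v).2 by rewrite -GT.
  exists (maxn j k) => //; split.
    by move: Fj; exact/subsetPset/ndF/leq_maxl.
  by move: Gk; exact/subsetPset/ndG/leq_maxr.
move=> k; have [mF Fkoo] := Foo k; have [mG Gkoo] := Goo k; split.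
  rewrite -[X in measurable X]setTI; apply: measurable_rV_uncons => //.
  exact: measurableX.
rewrite /rV_cons_measure /pushforward.
rewrite [X in product_measure1 _ _ X](_ : _ = F k `*` G k).
  by rewrite product_measure1E// lte_mul_pinfty// ge0_fin_numE.
by rewrite -comp_preimage (_ : _ \o _ = id) ?preimage_id//; exact/funext/rV_consK.
Qed.

HB.instance Definition _ := @Measure_isSigmaFinite.Build _ _ _
  rV_cons_measure rV_cons_measure_sigma_finite.

End cons_measure.

(* Lebesgue measure on R^n, built as the n-fold product of the one-dimensional
   one; lebesgue_rV_box below gives its value on boxes. *)
Fixpoint lebesgue_rV n : {sigma_finite_measure set 'rV[R]_n -> \bar R} :=
  if n is k.+1 then rV_cons_measure (lebesgue_rV k) else \d_(0 : 'rV[R]_0).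

Lemma lebesgue_rV_box n (A : 'I_n -> set (measurableTypeR R)) :
  (forall i, measurable (A i)) ->
  lebesgue_rV n [set v | forall i, A i (v ord0 i)] =
  (\prod_(i < n) lebesgue_measure (A i))%E.
Proof.
elim: n A => [|n IH] A mA.
  by rewrite big_ord0 /= diracE mem_set// => -[].
have mS : measurable
    [set v : 'rV[R]_n | forall i, A (lift ord0 i) (v ord0 i)].
  rewrite (_ : mkset _ = \bigcap_(i in [set: 'I_n])
      (fun v : 'rV[R]_n => v ord0 i) @^-1` A (lift ord0 i)).
    apply: fin_bigcap_measurable => // i _.
    rewrite -[X in measurable X]setTI; exact: measurable_rV_coord.
  by apply/seteqP; split => v /= vA i; [move=> _|]; exact: vA.
rewrite big_ord_recl -IH// -product_measure1E//.
rewrite /= /rV_cons_measure /pushforward; congr product_measure1.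
apply/seteqP; split => [[x v] /= h|[x v] [/= h1 h2] i].
  split; first by have := h ord0; rewrite mxE unlift_none.
  by move=> i; have := h (lift ord0 i); rewrite mxE liftK.
by rewrite mxE; case: unliftP => [j ->|->].
Qed.

End lebesgue_rV.

(* L_2 is represented by the square-integrable functions themselves (LfunType is
   an lmodType), and equality in L_2 by almost everywhere equality. *)
Notation L2 mu := (LfunType mu (lee1n 2)).
Notation Linf mu := (LfunType mu (leey 1%E)).

Section L2.
Context d (T : measurableType d) (R : realType).
Variable mu : {measure set T -> \bar R}.

Definition dotL2 (f g : T -> R) : R := \int[mu]_x (f x * g x).

Definition normL2 (f : T -> R) : R := fine ('N[mu]_2%:E[EFin \o f])%E.

Definition cvgL2 (u : nat -> L2 mu) (l : L2 mu) :=
  (fun k => normL2 (u k - l)) @ \oo --> (0 : R).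

(* Objects picked with xget are unique up to a.e. equality, and 0 is a junk value
   for the case where none exists. *)
Definition limL2 (u : nat -> L2 mu) : L2 mu := xget 0 [set l | cvgL2 u l].

(* Operators act on representatives: A must respect a.e. equality on X. *)
Definition linear_operator_on (X : set (L2 mu)) (A : L2 mu -> L2 mu) :=
  [/\ forall f : L2 mu, X f -> X (A f),
      forall f g : L2 mu, X f -> X g -> f = g %[ae mu] -> A f = A g %[ae mu] &
      forall (k : R) (f g : L2 mu), X f -> X g ->
        A (k *: f + g) = k *: A f + A g %[ae mu]].

Definition orthonormal_basis_of (X : set (L2 mu)) n (phi : 'I_n -> L2 mu) :=
  X = [set f : L2 mu |
        exists k : 'I_n -> R, f = \sum_(j < n) k j *: phi j %[ae mu]] /\
  forall j k, dotL2 (phi j) (phi k) = (j == k)%:R.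

Definition orthogonal_projection (X : set (L2 mu)) (f : L2 mu) : L2 mu :=
  xget 0 [set w | X w /\ forall v, X v -> dotL2 (f - w) v = 0].

Definition exp_operator (A : L2 mu -> L2 mu) (t : R) (f : L2 mu) : L2 mu :=
  limL2 (fun N => \sum_(0 <= l < N) (t ^+ l / l`!%:R) *: iter l A f).

(* Strongly continuous one-parameter semigroup of bounded linear operators;
   S t matters only for t >= 0. *)
Definition C0_semigroup (S : R -> L2 mu -> L2 mu) :=
  [/\ forall t, 0 <= t -> linear_operator_on setT (S t) /\
        exists M, forall f, normL2 (S t f) <= M * normL2 f,
      forall f, S 0 f = f %[ae mu],
      forall s t f, 0 <= s -> 0 <= t -> S (s + t) f = S s (S t f) %[ae mu] &
      forall f, (fun t => normL2 (S t f - f)) @ 0^'+ --> (0 : R)].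

Definition generator (S : R -> L2 mu -> L2 mu) (f h : L2 mu) :=
  (fun t => normL2 (t^-1 *: (S t f - f) - h)) @ 0^'+ --> (0 : R).

(* The operator given by its graph A generates the C_0-semigroup S. *)
Definition generates (A : L2 mu -> L2 mu -> Prop) (S : R -> L2 mu -> L2 mu) :=
  C0_semigroup S /\ forall f h, A f h <-> generator S f h.

(* Bochner integral over D of an L_2-valued function F: the L_2-limit of the
   integrals of simple functions converging to F in L_1(D; L_2). *)
Section bochner.
Context d' (T' : measurableType d') (nu : {measure set T' -> \bar R}).
Variables (D : set T') (F : T' -> L2 mu).

Definition is_bochner_integral (w : L2 mu) :=
  exists (n : nat -> nat) (E : forall k, 'I_(n k) -> set T')
         (v : forall k, 'I_(n k) -> L2 mu),
    let s k (t : T') : L2 mu := \sum_(i < n k) (\1_(E k i) t : R) *: v k i in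
    [/\ forall k i, [/\ measurable (E k i), E k i `<=` D &
          (nu (E k i) < +oo)%E],
        forall k, measurable_fun D (fun t => normL2 (F t - s k t)),
        (fun k => \int[nu]_(t in D) (normL2 (F t - s k t))%:E)%E @ \oo --> 0%E &
        cvgL2 (fun k => \sum_(i < n k) fine (nu (E k i)) *: v k i) w].

Definition bochner_integral : L2 mu := xget 0 is_bochner_integral.

End bochner.
End L2.

Section Sobolev.
Context {R : realType} (n : nat) (Omega : set 'rV[R]_n).
Hypothesis oOmega : open Omega.

Definition lebesgue_on : {measure set 'rV[R]_n -> \bar R} :=
  mrestr (lebesgue_rV n) (open_measurable_rV oOmega).
Local Notation mu := lebesgue_on.

Definition partial (i : 'I_n) (f : 'rV[R]_n -> R) : 'rV[R]_n -> R :=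
  fun x => 'D_(delta_mx 0 i) f x.

Fixpoint class_C k (f : 'rV[R]_n -> R) : Prop :=
  if k is l.+1 then
    forall i, (forall x, derivable f x (delta_mx 0 i)) /\ class_C l (partial i f)
  else continuous f.

Definition test_function (f : 'rV[R]_n -> R) :=
  [/\ forall k, class_C k f, compact (closure [set x | f x != 0]) &
      closure [set x | f x != 0] `<=` Omega].

Definition is_weak_partial (i : 'I_n) (u w : L2 mu) :=
  forall f, test_function f ->
    \int[mu]_x (u x * partial i f x) = - \int[mu]_x (w x * f x).

Definition weak_partial (i : 'I_n) (u : L2 mu) : L2 mu :=
  xget 0 (is_weak_partial i u).

Definition H1 : set (L2 mu) :=
  [set u | forall i, exists w, is_weak_partial i u w].

(* The closure of C_c^oo(Omega) in H^1(Omega). *)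
Definition H10 : set (L2 mu) :=
  [set u | H1 u /\ forall e : R, 0 < e -> exists f, [/\ test_function f,
     ('N[mu]_2%:E[EFin \o (u \- f)%R] < e%:E)%E &
     forall i, ('N[mu]_2%:E[EFin \o (weak_partial i u \- partial i f)%R]
                < e%:E)%E]].

Definition sqnormH1 (u : L2 mu) : R :=
  normL2 mu u ^+ 2 + \sum_(i < n) normL2 mu (weak_partial i u) ^+ 2.

Definition bform (a : 'I_n -> 'I_n -> Linf mu) (b : 'I_n -> Linf mu)
    (c : Linf mu) (u v : L2 mu) : R :=
  \int[mu]_x (\sum_(i < n) \sum_(j < n)
                a i j x * weak_partial i u x * weak_partial j v x
              + \sum_(i < n) b i x * weak_partial i u x * v x
              + c x * u x * v x).

Definition garding (B : L2 mu -> L2 mu -> R) :=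
  exists kappa kappa0 : R, [/\ 0 <= kappa, 0 < kappa0 &
    forall f, H10 f ->
      kappa0 * sqnormH1 f <= B f f + kappa * normL2 mu f ^+ 2].

(* Graph of the operator A with <- A[f], v> = B[f, v] for all v in H^1_0. *)
Definition form_operator (B : L2 mu -> L2 mu -> R) (f h : L2 mu) :=
  H10 f /\ forall v, H10 v -> dotL2 mu (- h) v = B f v.

Definition galerkin_operator (B : L2 mu -> L2 mu -> R) (X : set (L2 mu))
    (AK : L2 mu -> L2 mu) :=
  linear_operator_on X AK /\
  forall f v, X f -> X v -> dotL2 mu (AK f) v = - B f v.

Section time.
Variable tF : R.

Lemma measurable_0tF : measurable (`]0, tF[%classic : set (measurableTypeR R)).
Proof. exact: measurable_itv. Qed.

Lemma lebesgue_0tF_lty : (@lebesgue_measure R `]0%R, tF[%classic < +oo)%E.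
Proof. by rewrite lebesgue_measure_itv; case: ifP => //= _; rewrite -EFinD ltry. Qed.

Definition lebesgue_time : {finite_measure set (measurableTypeR R) -> \bar R} :=
  mfrestr measurable_0tF lebesgue_0tF_lty.

Definition lebesgue_cylinder :
    {measure set ('rV[R]_n * measurableTypeR R) -> \bar R} :=
  mrestr (lebesgue_rV n \x @lebesgue_measure R)%E
    (measurableX (open_measurable_rV oOmega) measurable_0tF).

(* f(., t); it is in L_2(Omega) for almost every t, and replaced by 0 for the
   other ones. *)
Definition slice (f : L2 lebesgue_cylinder) (t : R) : L2 mu :=
  insubd (0 : L2 mu) (fun x => f (x, t)).

(* S(t)[g] + \int_0^t S(t - s)[f(., s)] ds *)
Definition mild_solution (S : R -> L2 mu -> L2 mu)
    (f : L2 lebesgue_cylinder) (g : L2 mu) (t : R) : L2 mu :=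
  S t g + bochner_integral (@lebesgue_measure R) `]0, t[
            (fun s => S (t - s) (slice f s)).

End time.
End Sobolev.
Arguments H1 {R n Omega} oOmega _.
Arguments H10 {R n Omega} oOmega _.

Section control.
Context {R : realType} (m : nat) (tF : R).

(* L_2(0, t_F)^m *)
Definition controls := {ffun 'I_m -> L2 (lebesgue_time tF)}.

Definition dotU (u v : controls) : R :=
  \sum_(i < m) dotL2 (lebesgue_time tF) (u i) (v i).

Definition sqnormU (u : controls) : R :=
  \sum_(i < m) normL2 (lebesgue_time tF) (u i) ^+ 2.

Lemma cst_Lfun2 (x : R) :
  (cst x : measurableTypeR R -> R) \in Lfun (lebesgue_time tF) 2%:E.
Proof. exact: Lfun_cst. Qed.

Definition cstU (x : 'I_m -> R) : controls :=
  [ffun i => Lfun_Sub (lee1n 2) (cst_Lfun2 (x i))].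

Definition colU (u : controls) (t : R) : 'cV[R]_m := \col_i (u i t).

Definition integral_mx p q (M : R -> 'M[R]_(p, q)) : 'M[R]_(p, q) :=
  \matrix_(i, j) \int[@lebesgue_measure R]_(t in `]0, tF[) M t i j.

End control.

Definition expmx {R : realType} n (A : 'M[R]_n) : 'M[R]_n :=
  limn (series (fun l => (l`!%:R)^-1 *: A ^+ l)).

Section galerkin.
Context {R : realType} (n : nat) (Omega : set 'rV[R]_n).
Variables (oOmega : open Omega) (m nK : nat) (tF : R).
Local Notation mu := (lebesgue_on oOmega).
Variables (B : L2 mu -> L2 mu -> R) (beta : 'I_m -> L2 mu).
Variables (X : set (L2 mu)) (phi : 'I_nK -> L2 mu) (AK : L2 mu -> L2 mu).

Definition TK (u : controls m tF) : L2 mu :=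
  bochner_integral (@lebesgue_measure R) `]0, tF[
    (fun t => exp_operator AK (tF - t)
      (orthogonal_projection X (\sum_(i < m) u i t *: beta i))).

Definition AKmx : 'M[R]_nK := \matrix_(k, l) - B (phi l) (phi k).

Definition Mbeta : 'M[R]_(nK, m) := \matrix_(k, i) dotL2 mu (beta i) (phi k).

Definition FK (t : R) : 'M[R]_(m, nK) :=
  Mbeta^T *m expmx ((tF - t) *: AKmx^T).

Definition GK : 'M[R]_nK := integral_mx tF (fun t => (FK t)^T *m FK t).

Definition xiK (la lb : controls m tF) : 'cV[R]_nK :=
  integral_mx tF (fun t => (FK t)^T *m (colU la t - colU lb t)).

End galerkin.

(* Main.v *)
(* In the coordinates of the orthonormal basis phi, the control-to-state map is
   u |-> (<f_j, u>)_j, where f_j is the j-th column of F_K: the projection, the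
   exponential of A_K and the Bochner integral all act on coordinate vectors.
   Hence Lag_K is a quadratic functional built from the f_j, with Gram matrix
   G_K. With w = (rho I + G_K)^-1 (theta - rho^-1 xi), its derivative vanishes
   at u_c = sum_j w_j f_j + rho^-1 (la - lb), and
   Lag_K(u) = Lag_K(u_c) + sum_j <f_j, u - u_c>^2 + rho ||u - u_c||^2. *)
Require Import Defs.
From HB Require Import structures.
From mathcomp Require Import all_boot all_order all_algebra.
From mathcomp Require Import all_classical all_reals all_analysis.
From mathcomp Require Import measurable_realfun ring lra.
Set Implicit Arguments.
Unset Strict Implicit.
Unset Printing Implicit Defensive.
Import Order.TTheory GRing.Theory Num.Theory.
Import numFieldNormedType.Exports.
Local Open Scope classical_set_scope.
Local Open Scope ring_scope.

(** The map [TK] is composed of objects chosen by [xget] (projection, limit of the exponential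
    series, Bochner integral), and each of them is the junk value 0 until existence is proved. So
    each one is treated twice: a combination of the [phi j] is shown to satisfy the defining
    property, and then the chosen object is shown to agree with it modulo null sets, an equality
    tested by inner products with every [h].

    Existence of a minimizer requires no compactness, because the expansion around u_c is exact; its
    term rho ||u - u_c||^2 gives uniqueness.

    The weight w does not involve alpha. The coefficient in the stated formula comes from (rho I +
    G_K)(rho^-1 I - (rho I + G_K)^-1) = rho^-1 G_K: applied to any alpha with G_K alpha = xi, it
    yields (rho I + G_K)^-1 (rho^-1 xi). Since G_K may be singular, solvability of G_K alpha = xi is
    a separate point, settled by a kernel argument. *)

Lemma cvg_dist_le (R : realType) (u v : nat -> R) (l : R) :
  (forall n, `|u n - l| <= v n) -> v @ \oo --> (0 : R) -> u @ \oo --> l.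
Proof.
move=> uv v0; apply/cvgrPdistC_le => e e0.
near=> n; apply: le_trans (uv n) _; apply: le_trans (ler_norm _) _.
by near: n; exact: (cvgr0_norm_le _ v0).
Unshelve. all: by end_near. Qed.

Lemma cvg_sumR (R : realType) (I : Type) (r : seq I) (u : I -> nat -> R)
    (l : I -> R) (a : R) :
  (forall i, u i @ \oo --> l i) -> \sum_(i <- r) l i = a ->
  (fun k => \sum_(i <- r) u i k) @ \oo --> a.
Proof.
move=> ul <-; elim: r => [|i r ih].
  by rewrite big_nil; under eq_fun do rewrite big_nil; exact: cvg_cst.
by rewrite big_cons; under eq_fun do rewrite big_cons; exact: cvgD.
Qed.

(** * Inner product and seminorm on representatives of L_2 *)

Section L2_theory.
Context d (T : measurableType d) (R : realType).
Variable mu : {measure set T -> \bar R}.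
Local Notation dot := (dotL2 mu).
Local Notation nrm := (normL2 mu).
Implicit Types f g h : L2 mu.

Lemma dotL2_integrable f g :
  mu.-integrable setT (EFin \o (fun x => f x * g x)).
Proof.
by apply/Lfun1_integrable; apply: Lfun2_mul_Lfun1; exact: LfunP.
Qed.

Lemma dotL2C (f g : T -> R) : dot f g = dot g f.
Proof. by apply: eq_Rintegral => x _; rewrite mulrC. Qed.

Lemma dotL2PZ (k : R) f g h : dot (k *: f + g) h = k * dot f h + dot g h.
Proof.
rewrite /dotL2.
rewrite (_ : k * _ = \int[mu]_x (k * (f x * h x))); last first.
  by rewrite RintegralZl//; exact: dotL2_integrable.
rewrite -RintegralD//; first last.
- exact: dotL2_integrable.
- have := dotL2_integrable (k *: f) h; congr integrable.
  by apply/funext => x /=; rewrite mulrA.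
by apply: eq_Rintegral => x _ /=; rewrite mulrDl mulrA.
Qed.

Lemma dot0L2 h : dot (0 : L2 mu) h = 0.
Proof.
have := dotL2PZ 1 0 0 h; rewrite scaler0 addr0 mul1r => /eqP.
by rewrite eq_sym -subr_eq0 addrK => /eqP.
Qed.

Lemma dotL2Dl f g h : dot (f + g) h = dot f h + dot g h.
Proof. by rewrite -[f]scale1r dotL2PZ scale1r mul1r. Qed.

Lemma dotL2Zl k f h : dot (k *: f) h = k * dot f h.
Proof. by rewrite -[k *: f]addr0 dotL2PZ dot0L2 addr0. Qed.

Lemma dotL2Nl f h : dot (- f) h = - dot f h.
Proof. by rewrite -scaleN1r dotL2Zl mulN1r. Qed.

Lemma dotL2Bl f g h : dot (f - g) h = dot f h - dot g h.
Proof. by rewrite dotL2Dl dotL2Nl. Qed.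

Lemma dotL2_suml (I : Type) (r : seq I) (P : pred I) (F : I -> L2 mu) h :
  dot (\sum_(i <- r | P i) F i : L2 mu) h = \sum_(i <- r | P i) dot (F i) h.
Proof.
elim/big_ind2: _ => //; first exact: dot0L2.
by move=> f a g b <- <-; rewrite dotL2Dl.
Qed.

Lemma dotL2Zr k f h : dot h (k *: f) = k * dot h f.
Proof. by rewrite dotL2C dotL2Zl [dot _ h]dotL2C. Qed.

Lemma dotL2Br f g h : dot h (f - g) = dot h f - dot h g.
Proof. by rewrite dotL2C dotL2Bl ![dot _ h]dotL2C. Qed.

Lemma dotL2_ge0 f : 0 <= dot f f.
Proof. by apply: Rintegral_ge0 => x _; rewrite -expr2 sqr_ge0. Qed.

Lemma normL2_ge0 (f : T -> R) : 0 <= nrm f.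
Proof. by rewrite fine_ge0// Lnorm_ge0. Qed.

Lemma normL2_sqr f : nrm f ^+ 2 = dot f f.
Proof.
rewrite -powR_mulrn ?normL2_ge0// /normL2 -fine_poweR poweR_Lnorm ?pnatr_eq0//.
rewrite /dotL2 /Rintegral; congr fine; apply: eq_integral => x _ /=.
by rewrite powR_mulrn// real_normK ?num_real// expr2.
Qed.

Lemma normL2E f : nrm f = Num.sqrt (dot f f).
Proof. by rewrite -normL2_sqr sqrtr_sqr ger0_norm// normL2_ge0. Qed.

Lemma ler_normL2D f g : nrm (f + g) <= nrm f + nrm g.
Proof. exact: ler_LnormD. Qed.

Lemma normL2Z k f : nrm (k *: f) = `|k| * nrm f.
Proof.
by rewrite !normL2E dotL2Zl dotL2Zr mulrA -expr2 sqrtrM ?sqr_ge0// sqrtr_sqr.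
Qed.

Lemma normL2_0 : nrm (0 : L2 mu) = 0.
Proof. by rewrite normL2E dot0L2 sqrtr0. Qed.

Lemma dotL2_cauchy_schwarz f g : `|dot f g| <= nrm f * nrm g.
Proof.
have nfg : 0 <= nrm f * nrm g by rewrite mulr_ge0// normL2_ge0.
rewrite -[leRHS]ger0_norm// -ler_sqr ?nnegrE ?normr_ge0//.
rewrite !real_normK ?num_real// exprMn !normL2_sqr.
(* The form is only semidefinite on representatives. If [g] is null, the square norm of [k *: g + f]
   is affine in [k]; were [dot f g] nonzero, the [k] chosen below would give it the value -1. *)
have [g0|gn0] := eqVneq (dot g g) 0.
  have : 0 <= dot f f by exact: dotL2_ge0.
  have k_ge0 k : 0 <= dot f f + 2 * k * dot f g.
    have := dotL2_ge0 (k *: g + f).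
    rewrite dotL2PZ !(dotL2C _ (k *: g + f)) !dotL2PZ g0 (dotL2C g f).
    by rewrite !mulr0 add0r; lra.
  rewrite g0 mulr0; have [->//|fg0] := eqVneq (dot f g) 0; first by rewrite expr0n.
  move=> ff; have := k_ge0 (- (dot f f + 1) / (2 * dot f g)).
  by rewrite [_ * dot f g](_ : _ = - (dot f f + 1)); [lra|field].
have g_gt0 : 0 < dot g g by rewrite lt_neqAle eq_sym gn0 dotL2_ge0.
(* This multiple of [g] minimizes the norm of the sum. *)
have := dotL2_ge0 ((- dot f g / dot g g) *: g + f).
set k := _ / _.
rewrite dotL2PZ !(dotL2C _ (k *: g + f)) !dotL2PZ (dotL2C g f).
have -> : k * (k * dot g g + dot f g) = 0 by rewrite /k; field.
have -> : k * dot f g = - (dot f g ^+ 2 / dot g g) by rewrite /k; field.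
by rewrite add0r addrC subr_ge0 ler_pdivrMr.
Qed.

Lemma dotL2_null f g : dot f f = 0 -> dot f g = 0.
Proof.
move=> f0; apply/eqP; rewrite -normr_le0; apply: le_trans (dotL2_cauchy_schwarz _ _) _.
by rewrite normL2E f0 sqrtr0 mul0r.
Qed.

Lemma dotL2_ae (f f' g : L2 mu) : f = f' %[ae mu] -> dot f g = dot f' g.
Proof.
move=> ff'; rewrite /dotL2 /Rintegral; congr fine.
apply: ae_eq_integral => //.
- exact: measurable_int (dotL2_integrable f g).
- exact: measurable_int (dotL2_integrable f' g).
by apply: filterS ff' => x /= ff' _; rewrite ff'.
Qed.

Lemma dotL2_eq0 f : dot f f = 0 -> f = 0 %[ae mu].
Proof.
by move=> f0; apply: fine_Lnormr_eq0; rewrite -/(normL2 mu f) normL2E f0 sqrtr0.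
Qed.

(* Turns reasoning modulo null sets into linear algebra on inner products. *)
Lemma ae_eqL2P f g : f = g %[ae mu] <-> forall h, dot f h = dot g h.
Proof.
split=> [fg h|fg]; first exact: dotL2_ae.
have /dotL2_eq0 : dot (f - g) (f - g) = 0 by rewrite dotL2Bl fg subrr.
apply: filterS => x /= H xT; apply/eqP; rewrite -subr_eq0; apply/eqP; exact: H.
Qed.

Lemma normL2_ae f g : f = g %[ae mu] -> nrm f = nrm g.
Proof.
by move=> /ae_eqL2P fg; rewrite !normL2E fg dotL2C fg.
Qed.

Lemma cvgL2_dot (u : nat -> L2 mu) (l h : L2 mu) :
  cvgL2 u l -> (fun k => dot (u k) h) @ \oo --> dot l h.
Proof.
move=> ul; apply: (@cvg_dist_le _ _ (fun k => nrm (u k - l) * nrm h)).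
  by move=> k; rewrite -dotL2Bl; exact: dotL2_cauchy_schwarz.
by rewrite -[0](mul0r (nrm h)); apply: cvgMl.
Qed.

Lemma cvgL2_unique (u : nat -> L2 mu) (l l' : L2 mu) :
  cvgL2 u l -> cvgL2 u l' -> l = l' %[ae mu].
Proof.
move=> ul ul'; apply/ae_eqL2P => h.
exact: (cvg_unique (@Rhausdorff R) (cvgL2_dot ul) (cvgL2_dot ul')).
Qed.

(** The limit [l] witnesses that the set searched by [xget] is nonempty, which rules out the default
    0. *)
Lemma limL2_ae (u : nat -> L2 mu) (l : L2 mu) :
  cvgL2 u l -> limL2 u = l %[ae mu].
Proof.
by move=> ul; apply: (cvgL2_unique _ ul); rewrite /limL2; exact: (xgetPex 0 (ex_intro _ l ul)).
Qed.

Lemma normL2_sum_le (I : finType) (F : I -> L2 mu) :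
  nrm (\sum_(i : I) F i) <= \sum_i nrm (F i).
Proof.
elim/big_rec2: _ => [|i y x _ ih]; first by rewrite normL2_0.
by apply: le_trans (ler_normL2D _ _) _; rewrite lerD2l.
Qed.

End L2_theory.

(** * Entries of the matrix exponential: convergence, bounds, measurability *)

Section expmx_theory.
Context {R : realType} (n : nat).
Implicit Types M : 'M[R]_n.

Lemma cvg_mx p q (u : nat -> 'M[R]_(p, q)) (L : 'M[R]_(p, q)) :
  (forall i j, (fun N => u N i j) @ \oo --> L i j) -> u @ \oo --> L.
Proof.
move=> uL; apply/cvg_ballP => e e0.
have : \forall N \near \oo, forall ij : 'I_p * 'I_q,
    ball (L ij.1 ij.2) e (u N ij.1 ij.2).
  apply: filter_forall => -[i j] /=.
  by have /cvg_ballP := uL i j; exact.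
by apply: filterS => N h; split=> // i j; exact: (h (i, j)).
Qed.

Definition mx_abs_sum M : R := \sum_i \sum_j `|M i j|.

Lemma mx_abs_sum_ge0 M : 0 <= mx_abs_sum M.
Proof. by apply: sumr_ge0 => i _; exact: sumr_ge0. Qed.

Lemma mx_abs_sumZ (t : R) M : mx_abs_sum (t *: M) = `|t| * mx_abs_sum M.
Proof.
rewrite mulr_sumr; apply: eq_bigr => i _; rewrite mulr_sumr.
by apply: eq_bigr => j _; rewrite mxE normrM.
Qed.

(** The sum of all absolute entries dominates each absolute row sum, and this is all that the
    induction on the power uses. It makes the scalar series of exp([mx_abs_sum M]) a majorant for
    every entry. *)
Lemma ler_norm_exprmx M l i j : `|(M ^+ l) i j| <= mx_abs_sum M ^+ l.
Proof.
elim: l i j => [|l ih] i j.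
  by rewrite !expr0 mxE; case: (_ == _); rewrite ?normr1 ?normr0.
rewrite !exprS mxE; apply: le_trans (ler_norm_sum _ _ _) _.
have rowK : \sum_k `|M i k| <= mx_abs_sum M.
  rewrite /mx_abs_sum [leRHS](bigD1 i)//= lerDl.
  by apply: sumr_ge0 => k _; exact: sumr_ge0.
apply: le_trans (ler_wpM2r _ rowK); last by rewrite exprn_ge0 ?mx_abs_sum_ge0.
rewrite mulr_suml; apply: ler_sum => k _.
by rewrite normrM ler_wpM2l.
Qed.

Definition expmx_coef M i j (l : nat) : R := (l`!%:R)^-1 * (M ^+ l) i j.

Lemma ler_norm_expmx_coef M i j l :
  `|expmx_coef M i j l| <= exp_coeff (mx_abs_sum M) l.
Proof.
rewrite /expmx_coef /exp_coeff /= normrM mulrC [X in _ * X]ger0_norm ?invr_ge0 ?ler0n//.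
by rewrite ler_wpM2r ?invr_ge0 ?ler0n// ler_norm_exprmx.
Qed.

Lemma is_cvg_normed_series_expmx_coef M i j : cvgn [normed series (expmx_coef M i j)].
Proof.
apply: (@series_le_cvg _ _ (exp_coeff (mx_abs_sum M))).
- by move=> l /=; exact: normr_ge0.
- by move=> l; apply: exp_coeff_ge0; exact: mx_abs_sum_ge0.
- by move=> l /=; exact: ler_norm_expmx_coef.
- exact: is_cvg_series_exp_coeff.
Qed.

(** Each entry series converges absolutely by comparison with a scalar exponential series. Hence the
    matrix series has a genuine limit, which can be computed entry by entry. *)
Lemma expmxE M i j : expmx M i j = limn (series (expmx_coef M i j)).
Proof.
rewrite /expmx.
set L : 'M[R]_n := \matrix_(i, j) limn (series (expmx_coef M i j)).
rewrite (_ : limn _ = L) ?mxE//; apply: cvg_lim; first exact: norm_hausdorff.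
apply: cvg_mx => k l; rewrite mxE.
rewrite (_ : (fun N => _) = series (expmx_coef M k l)).
  exact/normed_cvg/is_cvg_normed_series_expmx_coef.
apply/funext => N; rewrite /series/= summxE.
by apply: eq_bigr => p _; rewrite mxE.
Qed.

Lemma cvg_series_expmx_coef M i j :
  series (expmx_coef M i j) @ \oo --> expmx M i j.
Proof.
by rewrite expmxE; exact/normed_cvg/is_cvg_normed_series_expmx_coef.
Qed.

Lemma ler_norm_expmx M i j : `|expmx M i j| <= expR (mx_abs_sum M).
Proof.
rewrite expmxE; apply: le_trans (lim_series_norm _) _.
  exact: is_cvg_normed_series_expmx_coef.
apply: lim_series_le.
- exact: is_cvg_normed_series_expmx_coef.
- exact: is_cvg_series_exp_coeff.
- by move=> l /=; exact: ler_norm_expmx_coef.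
Qed.

Lemma trmx_expmx M : (expmx M)^T = expmx M^T.
Proof.
apply/matrixP => i j; rewrite mxE !expmxE; congr (limn (series _)).
apply/funext => l; rewrite /expmx_coef; congr (_ * _).
elim: l i j => [|l ih] i j; first by rewrite !expr0 !mxE eq_sym.
rewrite exprSr exprS !mxE; apply: eq_bigr => k _.
by rewrite ih mxE mulrC.
Qed.

Lemma exprmxZ (t : R) M l : (t *: M) ^+ l = t ^+ l *: M ^+ l.
Proof.
elim: l => [|l ih]; first by rewrite !expr0 scale1r.
rewrite !exprS ih -[LHS]/((t *: M) *m (t ^+ l *: M ^+ l)).
by rewrite -scalemxAl -scalemxAr scalerA.
Qed.

(** The partial sums are polynomials in [t], and measurability passes to pointwise limits. *)
Lemma measurable_expmx M i j :
  measurable_fun setT (fun t : measurableTypeR R => expmx (t *: M) i j).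
Proof.
apply: (@measurable_fun_cvg _ _ _ _
  (fun N (t : measurableTypeR R) => series (expmx_coef (t *: M) i j) N)).
  move=> N; rewrite /series /=; apply: measurable_sum => l.
  rewrite /expmx_coef.
  rewrite (_ : (fun t : R => _) = (fun t => (t ^+ l) * ((l`!%:R)^-1 * (M ^+ l) i j))); last first.
    by apply/funext => t; rewrite exprmxZ mxE mulrCA.
  by apply: measurable_funM => //; exact: measurable_funX.
by move=> t _; exact: cvg_series_expmx_coef.
Qed.

End expmx_theory.

(** * Projection, Galerkin operator and its exponential in an orthonormal basis *)

Section coordinates.
Context d (T : measurableType d) (R : realType).
Variable mu : {measure set T -> \bar R}.
Local Notation dot := (dotL2 mu).
Local Notation nrm := (normL2 mu).
Variables (n : nat) (phi : 'I_n -> L2 mu).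

Definition lincomb (k : 'cV[R]_n) : L2 mu := \sum_j k j 0 *: phi j.

Lemma dot_lincomb k (h : L2 mu) : dot (lincomb k) h = \sum_j k j 0 * dot (phi j) h.
Proof. by rewrite /lincomb dotL2_suml; apply: eq_bigr => j _; rewrite dotL2Zl. Qed.

Lemma lincombPZ a k l : lincomb (a *: k + l) = a *: lincomb k + lincomb l.
Proof.
rewrite /lincomb scaler_sumr -big_split; apply: eq_bigr => j _.
by rewrite !mxE scalerDl scalerA.
Qed.

Lemma lincomb0 : lincomb 0 = 0.
Proof. by apply: big1 => j _; rewrite mxE scale0r. Qed.

Lemma lincombB k l : lincomb (k - l) = lincomb k - lincomb l.
Proof.
by rewrite -scaleN1r addrC lincombPZ scaleN1r addrC.
Qed.

Lemma lincomb_delta j : lincomb (delta_mx j 0) = phi j.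
Proof.
rewrite /lincomb (bigD1 j)//= mxE !eqxx scale1r big1 ?addr0// => i ij.
by rewrite mxE (negbTE ij) scale0r.
Qed.

Variable X : set (L2 mu).
Hypothesis phiP : orthonormal_basis_of X phi.

Lemma basis_memP f : X f <-> exists k, f = lincomb k %[ae mu].
Proof.
rewrite {1}phiP.1; split=> -[k fk].
  exists (\col_j k j); rewrite /lincomb.
  by under eq_bigr do rewrite mxE.
by exists (fun j => k j 0).
Qed.

Lemma basis_mem_lincomb k : X (lincomb k).
Proof. by apply/basis_memP; exists k; apply/ae_eqL2P. Qed.

Lemma basis_mem_phi j : X (phi j).
Proof. by rewrite -lincomb_delta; exact: basis_mem_lincomb. Qed.

Lemma dot_lincomb_phi k j : dot (lincomb k) (phi j) = k j 0.
Proof.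
rewrite dot_lincomb (bigD1 j)//= phiP.2 eqxx mulr1 big1 ?addr0// => i ij.
by rewrite phiP.2 (negbTE ij) mulr0.
Qed.

Definition coords (f : L2 mu) : 'cV[R]_n := \col_j dot f (phi j).

Lemma basis_coords f : X f -> f = lincomb (coords f) %[ae mu].
Proof.
move=> /basis_memP[k fk].
suff -> : coords f = k by [].
apply/colP => j; rewrite mxE -(dot_lincomb_phi k).
exact: dotL2_ae.
Qed.

Lemma coordsPZ a f g : coords (a *: f + g) = a *: coords f + coords g.
Proof. by apply/colP => j; rewrite !mxE dotL2PZ. Qed.

Lemma coords_ae (f g : L2 mu) : f = g %[ae mu] -> coords f = coords g.
Proof. by move=> fg; apply/colP => j; rewrite !mxE; exact: dotL2_ae. Qed.

Lemma dot_lincombs k l : dot (lincomb k) (lincomb l) = \sum_j k j 0 * l j 0.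
Proof.
rewrite dot_lincomb; apply: eq_bigr => j _; rewrite dotL2C.
by rewrite dot_lincomb_phi.
Qed.

Lemma normL2_lincomb_le k : nrm (lincomb k) <= \sum_j `|k j 0|.
Proof.
apply: le_trans (normL2_sum_le _) _; apply: ler_sum => j _.
by rewrite normL2Z normL2E phiP.2 eqxx sqrtr1 mulr1.
Qed.

(** The combination with coefficients <f, phi_j> is itself an orthogonal projection, so [xget]
    returns one. Testing its orthogonality relation against each [phi j] then fixes all its
    coordinates. *)
Lemma projection_ae f :
  orthogonal_projection X f = lincomb (coords f) %[ae mu].
Proof.
set P := [set w | X w /\ forall v, X v -> dot (f - w) v = 0].
have P1 : P (lincomb (coords f)).
  split; first exact: basis_mem_lincomb.
  move=> v /basis_coords /ae_eqL2P vE; rewrite dotL2C vE dot_lincomb.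
  apply: big1 => j _; rewrite dotL2Br [dot _ (lincomb _)]dotL2C.
  by rewrite dot_lincomb_phi !mxE [dot f _]dotL2C subrr mulr0.
have [Xw wP] : P (orthogonal_projection X f).
  exact: (xgetPex 0 (ex_intro _ _ P1)).
suff <- : coords (orthogonal_projection X f) = coords f.
  exact: basis_coords.
apply/colP => j; rewrite !mxE; apply/eqP; rewrite eq_sym -subr_eq0.
by rewrite -dotL2Bl wP//; exact: basis_mem_phi.
Qed.

Section operator.
Variables (A : L2 mu -> L2 mu) (M : 'M[R]_n).
Hypothesis A_lin : linear_operator_on X A.
Hypothesis AM : forall j k, dot (A (phi j)) (phi k) = M k j.

Let A_ae (f g : L2 mu) : X f -> X g -> f = g %[ae mu] -> A f = A g %[ae mu].
Proof. by case: A_lin => _ H _ Xf Xg fg; apply: (H f g). Qed.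

Let coords_A_lincomb k : coords (A (lincomb k)) = M *m k.
Proof.
have AD a f g : X f -> X g ->
    coords (A (a *: f + g)) = a *: coords (A f) + coords (A g).
  move=> Xf Xg; rewrite -coordsPZ; apply: coords_ae.
  by case: A_lin => _ _ H; exact: H.
have X0 : X 0 by rewrite -lincomb0; exact: basis_mem_lincomb.
have A0 : coords (A 0) = 0.
  have := AD 1 0 0 X0 X0; rewrite scaler0 addr0 scale1r => /eqP.
  by rewrite eq_sym -subr_eq0 addrK => /eqP.
(* Linearity of [A] is assumed only on [X] and modulo null sets. The induction over the sum
   therefore carries membership in [X] along, and compares coordinates, which do not see null
   sets. *)
suff [_ ->] : X (lincomb k) /\ coords (A (lincomb k)) = \sum_j k j 0 *: col j M.
  apply/colP => i; rewrite summxE mxE; apply: eq_bigr => j _.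
  by rewrite !mxE mulrC.
rewrite /lincomb; elim: (index_enum _) => [|j s [Xs ih]].
  by rewrite !big_nil.
rewrite !big_cons; split.
  move: Xs => /basis_memP[l sl]; apply/basis_memP.
  exists (k j 0 *: delta_mx j 0 + l); rewrite lincombPZ lincomb_delta.
  apply/ae_eqL2P => h; rewrite !dotL2PZ; congr (_ + _); exact: dotL2_ae.
rewrite AD//; last exact: basis_mem_phi.
rewrite ih; congr (_ *: _ + _).
by apply/colP => i; rewrite !mxE AM.
Qed.

(** Stated for any [f] that is a.e. a combination, because the image is again only known a.e.; this
    is what makes the statement iterable. *)
Lemma operator_lincomb (f : L2 mu) k :
  f = lincomb k %[ae mu] -> A f = lincomb (M *m k) %[ae mu].
Proof.
move=> fk; have Xf : X f by apply/basis_memP; exists k.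
rewrite -coords_A_lincomb -(coords_ae (A_ae Xf (basis_mem_lincomb k) fk)).
by apply: basis_coords; have [H _ _] := A_lin; exact: H.
Qed.

Lemma iter_operator_lincomb l (f : L2 mu) k :
  f = lincomb k %[ae mu] -> iter l A f = lincomb (M ^+ l *m k) %[ae mu].
Proof.
move=> fk; elim: l => [|l ih]; first by rewrite expr0 mul1mx.
rewrite iterS exprS -[M * _]/(M *m _) -mulmxA; exact: operator_lincomb.
Qed.

Lemma exp_operator_lincomb t (f : L2 mu) k :
  f = lincomb k %[ae mu] ->
  exp_operator A t f = lincomb (expmx (t *: M) *m k) %[ae mu].
Proof.
move=> fk; apply: limL2_ae.
(* The truncated matrix exponential. The partial sums of the operator series match it only modulo
   null sets, so they are compared by pairing with [h]. *)
pose S N : 'M[R]_n := \matrix_(i, j) series (expmx_coef (t *: M) i j) N.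
have SE N : \sum_(0 <= l < N) (t ^+ l / l`!%:R) *: iter l A f =
            lincomb (S N *m k) %[ae mu].
  apply/ae_eqL2P => h; rewrite dotL2_suml.
  transitivity (\sum_(0 <= l < N) (t ^+ l / l`!%:R) * dot (lincomb (M ^+ l *m k)) h).
    apply: eq_bigr => l _; rewrite dotL2Zl; congr (_ * _).
    by apply: dotL2_ae; exact: iter_operator_lincomb.
  transitivity (dot (lincomb (\sum_(0 <= l < N) (t ^+ l / l`!%:R) *: (M ^+ l *m k))) h).
    elim: N => [|N ih]; first by rewrite !big_nil lincomb0 dot0L2.
    by rewrite !big_nat_recr//= [in RHS]addrC lincombPZ dotL2PZ -ih addrC.
  congr (dot (lincomb _) h); apply/colP => i; rewrite summxE mxE.
  under [RHS]eq_bigr do rewrite mxE /series/= mulr_suml.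
  rewrite exchange_big/=; apply: eq_bigr => l _; rewrite mxE mxE mulr_sumr.
  apply: eq_bigr => j _; rewrite /expmx_coef exprmxZ mxE; ring.
(* The [phi j] have norm 1, so the L_2 error is at most the sum of the absolute coordinate errors.
   Convergence is thereby reduced to the entries of the matrix series. *)
apply: (@cvg_dist_le _ _ (fun N => \sum_i `|(S N *m k - expmx (t *: M) *m k) i 0|)).
  move=> N; rewrite subr0 ger0_norm ?normL2_ge0//.
  apply: le_trans (normL2_lincomb_le _); rewrite lincombB.
  rewrite le_eqVlt (normL2_ae (g := lincomb (S N *m k) - lincomb (expmx (t *: M) *m k))) ?eqxx//.
  apply/ae_eqL2P => h; rewrite !dotL2Bl; congr (_ - _); exact: dotL2_ae.
have S_cvg i : (fun N => (S N *m k - expmx (t *: M) *m k) i 0) @ \oo --> (0 : R).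
  have -> : (fun N => (S N *m k - expmx (t *: M) *m k) i 0) =
      (fun N => \sum_j (S N i j - expmx (t *: M) i j) * k j 0).
    apply/funext => N; rewrite !mxE -sumrB; apply: eq_bigr => j _.
    by rewrite mulrBl.
  apply: (@cvg_sumR R _ _ (fun j N => (S N i j - expmx (t *: M) i j) * k j 0)
                          (fun j => 0 * k j 0)) => [j|]; last first.
    by rewrite big1// => j _; rewrite mul0r.
  apply: cvgMl; rewrite -(subrr (expmx (t *: M) i j)).
  apply: cvgB; last exact: cvg_cst.
  under eq_fun do rewrite mxE.
  exact: cvg_series_expmx_coef.
apply: (@cvg_sumR R _ _ (fun i N => `|(S N *m k - expmx (t *: M) *m k) i 0|)
                        (fun=> `|0|)) => [i|].
  exact: cvg_norm.
by apply: big1 => j _; rewrite normr0.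
Qed.

End operator.
End coordinates.

(** * Bochner integrals of functions with values in the span of the basis *)

Lemma cvg_dist_ele (R : realType) (u : nat -> R) (l c : R) (e : nat -> \bar R) :
  (forall k, `|u k - l|%:E <= c%:E * e k)%E -> e @ \oo --> 0%E ->
  u @ \oo --> l.
Proof.
move=> ue e0; apply: (@cvg_dist_le _ _ (fun k => `|u k - l|)) => //.
have h : (fun k => `|u k - l|%:E) @ \oo --> 0%E.
  apply: (@squeeze_cvge _ _ _ _ (fun=> 0%E) _ (fun k => c%:E * e k)%E).
  - by near=> k; rewrite lee_fin normr_ge0 ue.
  - exact: cvg_cst.
  - by rewrite -(mule0 c%:E); exact: cvgeZl.
exact: (fine_cvg h).
Unshelve. all: by end_near. Qed.

Section Rintegral_sums.
Context d (T : measurableType d) (R : realType).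
Variables (nu : {measure set T -> \bar R}) (D : set T).
Hypothesis mD : measurable D.

Lemma integrable_sumR (I : Type) (r : seq I) (f : I -> T -> R) :
  (forall i, nu.-integrable D (EFin \o f i)) ->
  nu.-integrable D (EFin \o (fun t => \sum_(i <- r) f i t)).
Proof.
move=> fi; have := @integrable_sum _ _ _ nu _ mD _ r xpredT
  (fun i => EFin \o f i) (fun i _ => fi i).
by apply: eq_integrable => // t _ /=; rewrite sumEFin.
Qed.

Lemma Rintegral_sum (I : Type) (r : seq I) (f : I -> T -> R) :
  (forall i, nu.-integrable D (EFin \o f i)) ->
  \int[nu]_(t in D) (\sum_(i <- r) f i t) = \sum_(i <- r) \int[nu]_(t in D) f i t.
Proof.
move=> fi; elim: r => [|i r ih].
  rewrite big_nil -[RHS](Rintegral_set0 nu (fun=> 0)).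
  by rewrite /Rintegral; under eq_integral do rewrite big_nil; rewrite !integral0.
rewrite big_cons -ih -RintegralD//; last exact: integrable_sumR.
by apply: eq_Rintegral => t _; rewrite big_cons.
Qed.

Hypothesis nuD : (nu D < +oo)%E.
Variable E : set T.
Hypotheses (mE : measurable E) (ED : E `<=` D).

Lemma integrable_indic_sub (c : R) :
  nu.-integrable D (EFin \o (fun t => \1_E t * c)).
Proof.
have iE : nu.-integrable D (EFin \o \1_E).
  apply/integrableP; split.
    by apply/measurable_EFinP; exact: measurable_indic.
  under eq_integral do rewrite /= ger0_norm//.
  rewrite integral_indic//; apply: le_lt_trans nuD.
  by apply: le_measure; rewrite ?inE//; exact: measurableI.
exact: (integrableZr mD c iE).
Qed.

Lemma Rintegral_indic_sub (c : R) :
  \int[nu]_(t in D) (\1_E t * c) = fine (nu E) * c.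
Proof.
rewrite RintegralZr//.
  by rewrite /Rintegral integral_indic// setIidl.
by have := integrable_indic_sub 1; apply: eq_integrable => // t _ /=; rewrite mulr1.
Qed.

End Rintegral_sums.

Section bochner_lincomb.
Import HBSimple.
Context d (T : measurableType d) (R : realType).
Variable mu : {measure set T -> \bar R}.
Local Notation dot := (dotL2 mu).
Local Notation nrm := (normL2 mu).
Context d' (T' : measurableType d') (nu : {measure set T' -> \bar R}).
Variables (D : set T') (mD : measurable D) (nuD : (nu D < +oo)%E).
Variable F : T' -> L2 mu.

(* Pairing with h: |<sum_i nu(E_i) v_i, h> - int <F, h>| <= ||h|| int ||F - s_k||,
   where s_k are the simple functions approximating F. *)
Lemma bochner_dot w (h : L2 mu) :
  is_bochner_integral nu D F w ->
  nu.-integrable D (EFin \o (fun t => dot (F t) h)) ->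
  dot w h = \int[nu]_(t in D) dot (F t) h.
Proof.
move=> [n [E [v]]] /= [mE ms sF Iw] iF.
apply: (cvg_unique (@Rhausdorff R) (cvgL2_dot Iw)).
apply: (cvg_dist_ele (c := nrm h) _ sF) => k.
pose s t : L2 mu := \sum_(i < n k) (\1_(E k i) t : R) *: v k i.
have sE t : dot (s t) h = \sum_(i < n k) \1_(E k i) t * dot (v k i) h.
  by rewrite dotL2_suml; apply: eq_bigr => i _; rewrite dotL2Zl.
have iE i : nu.-integrable D (EFin \o (fun t => \1_(E k i) t * dot (v k i) h)).
  by case: (mE k i) => mEi Ei _; exact: integrable_indic_sub.
have is_ : nu.-integrable D (EFin \o (fun t => dot (s t) h)).
  have := integrable_sumR mD (index_enum 'I_(n k)) iE.
  by apply: eq_integrable => // t _ /=; rewrite sE.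
have -> : dot (\sum_(i < n k) fine (nu (E k i)) *: v k i : L2 mu) h =
          \int[nu]_(t in D) dot (s t) h.
  under eq_Rintegral do rewrite sE.
  rewrite Rintegral_sum// dotL2_suml; apply: eq_bigr => i _.
  by case: (mE k i) => mEi Ei _; rewrite dotL2Zl Rintegral_indic_sub.
rewrite -RintegralB//.
have id_ : nu.-integrable D (EFin \o (fun t => dot (s t) h - dot (F t) h)).
  have := integrableB mD is_ iF.
  by apply: eq_integrable => // t _ /=; rewrite EFinB.
rewrite EFin_normr_Rintegral//.
apply: le_trans (le_abse_integral _ mD (measurable_int _ id_)) _.
rewrite -ge0_integralZl_EFin//; first last.
- by rewrite normL2_ge0.
- by apply/measurable_EFinP; exact: ms.
- by move=> t _; rewrite lee_fin normL2_ge0.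
apply: ge0_le_integral => //.
- exact (measurable_int _ (integrable_abse id_)).
- by apply/measurable_EFinP; apply: measurable_funM => //; exact: ms.
move=> t _ /=; rewrite lee_fin distrC -dotL2Bl mulrC.
exact: dotL2_cauchy_schwarz.
Qed.

Variables (n : nat) (X : set (L2 mu)) (phi : 'I_n -> L2 mu).
Hypothesis phiP : orthonormal_basis_of X phi.
Variable y : 'I_n -> T' -> R.
Hypothesis FE : forall t, D t -> F t = lincomb phi (\col_j y j t) %[ae mu].
Hypothesis iy : forall j, nu.-integrable D (EFin \o y j).

Let Iy : L2 mu := lincomb phi (\col_j \int[nu]_(t in D) y j t).

(** Written as a sum over a list, so that the lists of values of all coordinates can be
    concatenated. *)
Lemma sfun_sum_indic (g : {sfun T' >-> R}) t :
  g t = \sum_(z <- finmap.enum_fset (fset_set (range g))) z * \1_(g @^-1` [set z]) t.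
Proof. by rewrite [LHS]fimfunE fsbig_finite. Qed.

(** Each scalar coordinate [y j] is approximated in L_1 by scalar simple functions [g j k].
    Multiplying by [phi j] and adding over [j] gives vector-valued simple functions whose integrals
    converge to [Iy]. *)
Lemma is_bochner_integral_lincomb : is_bochner_integral nu D F Iy.
Proof.
have /choice[g gP] := fun j => approximation_sfun_integrable mD (iy j).
(* A pair [(j, z)] stands for the value [z *: phi j], taken where coordinate [j] of the
   approximation equals [z]. Sets for different [j] overlap, which the definition of the integral
   permits. *)
pose r k : seq ('I_n * R) :=
  [seq (j, z) | j <- index_enum 'I_n,
                z <- finmap.enum_fset (fset_set (range (g j k)))].
pose code k (i : 'I_(size (r k))) := tnth (in_tuple (r k)) i.
(* Intersecting with [D] keeps the sets inside the domain and gives them finite measure, including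
   the level set of the value 0. *)
pose E k (c : 'I_n * R) : set T' := D `&` g c.1 k @^-1` [set c.2].
have mE k c : measurable (E k c).
  by apply: measurableI => //; exact: measurable_funPTI.
have ED k c : E k c `<=` D by exact: subIsetl.
have gE j k t : D t -> g j k t =
    \sum_(z <- finmap.enum_fset (fset_set (range (g j k)))) \1_(E k (j, z)) t * z.
  move=> Dt; rewrite [LHS]sfun_sum_indic; apply: eq_bigr => z _.
  by rewrite mulrC !indicE /E in_setI [t \in D]mem_set.
have IgE j k : \int[nu]_(t in D) g j k t =
    \sum_(z <- finmap.enum_fset (fset_set (range (g j k)))) fine (nu (E k (j, z))) * z.
  transitivity (\int[nu]_(t in D) \sum_(z <- finmap.enum_fset (fset_set (range (g j k))))
      \1_(E k (j, z)) t * z).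
    by apply: eq_Rintegral => t; rewrite inE => Dt; exact: gE.
  rewrite Rintegral_sum//; last by move=> z; exact: integrable_indic_sub.
  by apply: eq_bigr => z _; rewrite Rintegral_indic_sub.
(* Used twice: with [f] an indicator it evaluates the simple function, with [f] a measure its
   integral. *)
have combE k (f : 'I_n * R -> R) : \sum_(i < size (r k)) f (code k i) *:
      ((code k i).2 *: phi (code k i).1) =
    lincomb phi (\col_j \sum_(z <- finmap.enum_fset (fset_set (range (g j k)))) f (j, z) * z).
  rewrite -(big_tnth 0 +%R (r k) xpredT (fun c => f c *: (c.2 *: phi c.1))).
  rewrite big_allpairs_dep; apply: eq_bigr => j _; rewrite mxE scaler_suml.
  by apply: eq_bigr => z _ /=; rewrite scalerA.
have sE k t : D t -> \sum_(i < size (r k)) (\1_(E k (code k i)) t : R) *: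
      ((code k i).2 *: phi (code k i).1) = lincomb phi (\col_j g j k t).
  move=> Dt; rewrite (combE k (fun c => \1_(E k c) t)); congr lincomb.
  by apply/colP => j; rewrite !mxE gE.
have nE k t : D t -> nrm (F t - \sum_(i < size (r k))
      (\1_(E k (code k i)) t : R) *: ((code k i).2 *: phi (code k i).1)) =
    nrm (lincomb phi (\col_j (y j t - g j k t))).
  move=> Dt; rewrite sE//; apply: normL2_ae; apply/ae_eqL2P => h.
  rewrite dotL2Bl (dotL2_ae _ (FE Dt)) -dotL2Bl -lincombB.
  by congr (dot (lincomb _ _) _); apply/colP => j; rewrite !mxE.
have mg j k : measurable_fun D (g j k).
  exact: measurable_funP.
have my j : measurable_fun D (y j).
  by apply/measurable_EFinP; exact: measurable_int (iy j).
have mn k : measurable_fun D (fun t => nrm (lincomb phi (\col_j (y j t - g j k t)))).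
  (* By orthonormality the norm is Euclidean in the coordinates, and measurability follows. *)
  rewrite (_ : (fun t => _) = Num.sqrt \o
      (fun t => \sum_j (y j t - g j k t) * (y j t - g j k t))); last first.
    apply/funext => t; rewrite normL2E (dot_lincombs phiP); congr Num.sqrt.
    by apply: eq_bigr => j _; rewrite !mxE.
  apply: (measurableT_comp (continuous_measurable_fun (@sqrt_continuous R))).
  apply: measurable_sum => j.
  by apply: measurable_funM; exact: measurable_funB.
exists (fun k => size (r k)), (fun k i => E k (code k i)),
  (fun k i => (code k i).2 *: phi (code k i).1) => /=; split.
- move=> k i; split => //.
  by apply: le_lt_trans nuD; apply: le_measure; rewrite ?inE.
- by move=> k; apply: eq_measurable_fun (mn k) => t /set_mem Dt; rewrite nE.
- apply: (@squeeze_cvge _ _ _ _ (fun=> 0%E) _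
    (fun k => \sum_j \int[nu]_(t in D) `|(y j t)%:E - (g j k t)%:E|)%E).
  + near=> k; apply/andP; split.
      by apply: integral_ge0 => t _; rewrite lee_fin normL2_ge0.
    rewrite -ge0_integral_sum//; last first.
      move=> j; apply: measurableT_comp => //.
      by apply: emeasurable_funB; exact/measurable_EFinP.
    apply: ge0_le_integral => //.
    * by move=> t _; rewrite lee_fin normL2_ge0.
    * apply/measurable_EFinP; apply: eq_measurable_fun (mn k) => t /set_mem Dt.
      by rewrite nE.
    * apply: emeasurable_sum => j; apply: measurableT_comp => //.
      by apply: emeasurable_funB; exact/measurable_EFinP.
    * move=> t Dt; rewrite nE//.
      under eq_bigr do rewrite -EFinB abse_EFin.
      rewrite sumEFin lee_fin; apply: le_trans (normL2_lincomb_le phiP _) _.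
      by apply: ler_sum => j _; rewrite mxE.
  + exact: cvg_cst.
  + have h : (fun k => \sum_j \int[nu]_(t in D) `|(y j t)%:E - (g j k t)%:E|)%E
        @ \oo --> (\sum_(j < n) (0 : \bar R))%E.
      apply: cvg_nnesum => j _; last by have [] := gP j.
      by near=> k; apply: integral_ge0.
    by move: h; rewrite big1.
- have IE k : \sum_(i < size (r k)) fine (nu (E k (code k i))) *:
      ((code k i).2 *: phi (code k i).1) =
      lincomb phi (\col_j \int[nu]_(t in D) g j k t).
    rewrite (combE k (fun c => fine (nu (E k c)))); congr lincomb.
    by apply/colP => j; rewrite !mxE IgE.
  apply: (@cvg_dist_le _ _
    (fun k => \sum_j `|\int[nu]_(t in D) g j k t - \int[nu]_(t in D) y j t|)).
    move=> k; rewrite subr0 ger0_norm ?normL2_ge0// IE -lincombB.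
    apply: le_trans (normL2_lincomb_le phiP _) _.
    by apply: ler_sum => j _; rewrite !mxE.
  apply: (@cvg_sumR R _ _ (fun j k => `|\int[nu]_(t in D) g j k t - \int[nu]_(t in D) y j t|)
                          (fun=> 0)) => [j|]; last by rewrite big1.
  have [ig _ gy] := gP j.
  apply: (cvg_dist_ele (c := 1) _ gy) => k.
  rewrite subr0 normr_id mul1e -RintegralB//.
  have id_ : nu.-integrable D (EFin \o (fun t => g j k t - y j t)).
    have := integrableB mD (ig k) (iy j).
    by apply: eq_integrable => // t _ /=; rewrite EFinB.
  rewrite EFin_normr_Rintegral//.
  apply: le_trans (le_abse_integral _ mD (measurable_int _ id_)) _.
  rewrite le_eqVlt; apply/orP; left; apply/eqP; apply: eq_integral => t _ /=.
  by rewrite distrC.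
Unshelve. all: by end_near. Qed.

(** Existence makes the chosen value a true Bochner integral; it and [Iy] have the same pairing with
    every [h], namely the integral of <F, h>. *)
Lemma bochner_integral_lincomb : bochner_integral nu D F = Iy %[ae mu].
Proof.
set w := bochner_integral nu D F.
have wP : is_bochner_integral nu D F w.
  exact: (xgetPex 0 (ex_intro _ _ is_bochner_integral_lincomb)).
apply/ae_eqL2P => h.
have iF : nu.-integrable D (EFin \o (fun t => dot (F t) h)).
  have := integrable_sumR mD (index_enum 'I_n)
    (fun j => integrableZr mD (dot (phi j) h) (iy j)).
  apply: eq_integrable => // t /set_mem Dt /=.
  rewrite (dotL2_ae _ (FE Dt)) dot_lincomb; congr EFin.
  by apply: eq_bigr => j _; rewrite mxE.
by rewrite (bochner_dot wP iF) (bochner_dot is_bochner_integral_lincomb iF).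
Qed.

End bochner_lincomb.

(** * The semi-inner product on the control space *)

Section controls_theory.
Context {R : realType} (m : nat) (tF : R).
Local Notation controls := (controls m tF).
Local Notation dotU := (@dotU R m tF).
Implicit Types u v w : controls.

Lemma dotUC u v : dotU u v = dotU v u.
Proof. by apply: eq_bigr => i _; rewrite dotL2C. Qed.

Lemma dotUPZ k u v w : dotU (k *: u + v) w = k * dotU u w + dotU v w.
Proof.
rewrite mulr_sumr -big_split; apply: eq_bigr => i _.
by rewrite !ffunE dotL2PZ.
Qed.

Lemma dot0U w : dotU 0 w = 0.
Proof. by apply: big1 => i _; rewrite ffunE dot0L2. Qed.

Lemma dotUDl u v w : dotU (u + v) w = dotU u w + dotU v w.
Proof. by rewrite -[u]scale1r dotUPZ scale1r mul1r. Qed.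

Lemma dotUZl k u w : dotU (k *: u) w = k * dotU u w.
Proof. by rewrite -[k *: u]addr0 dotUPZ dot0U addr0. Qed.

Lemma dotUBl u v w : dotU (u - v) w = dotU u w - dotU v w.
Proof. by rewrite addrC -scaleN1r dotUPZ mulN1r addrC. Qed.

Lemma dotUDr u v w : dotU w (u + v) = dotU w u + dotU w v.
Proof. by rewrite dotUC dotUDl ![dotU _ w]dotUC. Qed.

Lemma dotUBr u v w : dotU w (u - v) = dotU w u - dotU w v.
Proof. by rewrite dotUC dotUBl ![dotU _ w]dotUC. Qed.

Lemma dotU_suml (I : Type) (r : seq I) (F : I -> controls) w :
  dotU (\sum_(i <- r) F i) w = \sum_(i <- r) dotU (F i) w.
Proof.
elim/big_ind2: _ => //; first exact: dot0U.
by move=> f a g b <- <-; rewrite dotUDl.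
Qed.

Lemma dotU_ge0 u : 0 <= dotU u u.
Proof. by apply: sumr_ge0 => i _; exact: dotL2_ge0. Qed.

Lemma sqnormUE u : sqnormU u = dotU u u.
Proof. by apply: eq_bigr => i _; rewrite normL2_sqr. Qed.

Lemma dotU_eq0 u i : dotU u u = 0 -> dotL2 (lebesgue_time tF) (u i) (u i) = 0.
Proof.
move=> /eqP; rewrite psumr_eq0 => [/allP u0|j _]; last exact: dotL2_ge0.
by apply/eqP/u0; rewrite mem_index_enum.
Qed.

Lemma dotU_null u w : dotU u u = 0 -> dotU u w = 0.
Proof. by move=> u0; apply: big1 => i _; apply: dotL2_null; exact: dotU_eq0. Qed.

End controls_theory.

(** * Passing from a restricted measure to integration over a subset *)

Section restriction.
Context d (T : measurableType d) (R : realType).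
Variables (mu nu : {measure set T -> \bar R}) (D : set T).
Hypothesis mD : measurable D.
Hypothesis nuE : forall A, measurable A -> nu A = mu (A `&` D).

(** The complement of [D] is null for [nu], and both measures agree on measurable subsets of [D].
    This links inner products for [lebesgue_time] to the Lebesgue integrals over the interval that
    define [GK] and [xiK]. *)
Lemma ge0_integral_restr (f : T -> \bar R) : measurable_fun setT f ->
  (forall x, 0 <= f x)%E -> (\int[nu]_x f x = \int[mu]_(x in D) f x)%E.
Proof.
move=> mf f0; rewrite (@ge0_negligible_integral _ _ _ _ _ (~` D))//.
- rewrite setDE setCK setTI; apply: eq_measure_integral => A mA AD.
  by rewrite nuE// setIidl.
- exact: measurableC.
- by rewrite nuE ?setICl ?measure0//; exact: measurableC.
Qed.

Lemma Rintegral_restr (f : T -> R) : measurable_fun setT f ->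
  \int[nu]_x f x = \int[mu]_(x in D) f x.
Proof.
move=> /measurable_EFinP mf; rewrite /Rintegral; congr fine.
rewrite integralE [RHS]integralE !ge0_integral_restr//.
- exact: measurable_funeneg.
- exact: measurable_funepos.
Qed.

Lemma integrable_restr (f : T -> \bar R) :
  nu.-integrable setT f -> mu.-integrable D f.
Proof.
move=> /integrableP[mf fi]; apply/integrableP; split.
  exact: measurable_funS mf.
by rewrite -ge0_integral_restr//; exact: measurableT_comp.
Qed.

End restriction.

Section time.
Context {R : realType} (tF : R).
Local Notation mu := (@lebesgue_measure R).
Local Notation D := (`]0, tF[%classic : set (measurableTypeR R)).

Let timeE A : measurable A -> lebesgue_time tF A = mu (A `&` D).
Proof. by []. Qed.

Lemma dotL2_time (f g : L2 (lebesgue_time tF)) :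
  dotL2 (lebesgue_time tF) f g = \int[mu]_(t in `]0, tF[) (f t * g t).
Proof.
by apply: (Rintegral_restr (measurable_0tF tF) timeE); exact: measurable_funM.
Qed.

Lemma integrable_time (f g : L2 (lebesgue_time tF)) :
  mu.-integrable D (EFin \o (fun t => f t * g t)).
Proof. exact: (integrable_restr (measurable_0tF tF) timeE (dotL2_integrable f g)). Qed.

Lemma bounded_Lfun_time (f : measurableTypeR R -> R) (C : R) :
  measurable_fun setT f -> (forall t, D t -> `|f t| <= C) ->
  f \in Lfun (lebesgue_time tF) 2%:E.
Proof.
move=> mf fC; rewrite inE; apply/andP; split; rewrite inE//=.
rewrite /finite_norm unlock /=; apply: poweR_lty.
have mp : measurable_fun setT (fun t => `|(f t)%:E| `^ 2)%E.
  under eq_fun do rewrite abse_EFin poweR_EFin.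
  apply/measurable_EFinP; apply: (measurableT_comp (measurable_powR _)) => //.
  exact: measurableT_comp.
rewrite (ge0_integral_restr (measurable_0tF tF) timeE)//.
apply: (@le_lt_trans _ _ (\int[mu]_(t in D) (C `^ 2)%:E)%E); last first.
  by rewrite integral_cst// lte_mul_pinfty ?lee_fin ?powR_ge0//; exact: lebesgue_0tF_lty.
apply: ge0_le_integral => //.
- exact: measurable_funS mp.
move=> t Dt; rewrite /= lee_fin ge0_ler_powR ?nnegrE ?fC//.
by apply: le_trans (fC _ Dt).
Qed.

End time.

(** * The columns of F_K as controls, and the coordinates of the control-to-state map *)

Section FK_columns.
Context {R : realType} (n : nat) (Omega : set 'rV[R]_n).
Variables (oOmega : open Omega) (m nK : nat) (tF : R).
Local Notation mu := (lebesgue_on oOmega).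
Variables (B : L2 mu -> L2 mu -> R) (beta : 'I_m -> L2 mu).
Variables (X : set (L2 mu)) (phi : 'I_nK -> L2 mu) (AK : L2 mu -> L2 mu).
Local Notation F := (FK tF B beta phi).

Lemma FK_Lfun i j :
  (fun t : measurableTypeR R => F t i j) \in Lfun (lebesgue_time tF) 2%:E.
Proof.
pose K := mx_abs_sum (AKmx B phi)^T.
(* On the interval |t_F - t| is at most t_F, so every entry of the exponential is bounded by exp(t_F
   K). *)
apply: (@bounded_Lfun_time _ _ _
  (\sum_k `|(Mbeta beta phi)^T i k| * expR (tF * K))).
  under eq_fun do rewrite mxE.
  apply: measurable_sum => k; apply: measurable_funM => //.
  apply: (measurableT_comp (measurable_expmx _ _ _)).
  exact: measurable_funB.
move=> t /=; rewrite in_itv/= => /andP[t0 tF_]; rewrite mxE.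
apply: le_trans (ler_norm_sum _ _ _) _; apply: ler_sum => k _.
rewrite normrM ler_wpM2l//; apply: le_trans (ler_norm_expmx _ _ _) _.
rewrite ler_expR mx_abs_sumZ ler_wpM2r ?mx_abs_sum_ge0//.
by rewrite ger0_norm; lra.
Qed.

Definition FKcol (j : 'I_nK) : controls m tF :=
  [ffun i => Lfun_Sub (lee1n 2) (FK_Lfun i j)].

Lemma FKcolE j i t : FKcol j i t = F t i j.
Proof. by rewrite ffunE. Qed.

Lemma mul_trFK j (v : 'cV[R]_m) t :
  ((F t)^T *m v) j 0 = \sum_i FKcol j i t * v i 0.
Proof.
by rewrite mxE; apply: eq_bigr => i _; rewrite [(_^T) _ _]mxE FKcolE.
Qed.

Lemma integral_FKcol j (u : controls m tF) :
  \int[@lebesgue_measure R]_(t in `]0, tF[) ((F t)^T *m colU u t) j 0 =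
  dotU (FKcol j) u.
Proof.
rewrite /dotU; under [RHS]eq_bigr do rewrite dotL2_time.
rewrite -Rintegral_sum//.
- by apply: eq_Rintegral => t _; rewrite mul_trFK; apply: eq_bigr => i _; rewrite mxE.
- by move=> i; exact: integrable_time.
Qed.

Lemma GKE j k : GK tF B beta phi j k = dotU (FKcol j) (FKcol k).
Proof.
rewrite mxE -integral_FKcol; apply: eq_Rintegral => t _.
rewrite mul_trFK mxE; apply: eq_bigr => i _.
by rewrite [(_^T) _ _]mxE [colU _ _ _ _]mxE !FKcolE.
Qed.

Lemma xiKE la lb j : xiK B beta phi la lb j 0 = dotU (FKcol j) (la - lb).
Proof.
rewrite mxE -integral_FKcol; apply: eq_Rintegral => t _.
by rewrite !mul_trFK; apply: eq_bigr => i _; rewrite !mxE !ffunE.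
Qed.

Hypothesis phiP : orthonormal_basis_of X phi.
Hypothesis AKP : galerkin_operator B X AK.

Lemma TK_lincomb (u : controls m tF) :
  TK beta X AK u = lincomb phi (\col_j dotU (FKcol j) u) %[ae mu].
Proof.
have -> : (\col_j dotU (FKcol j) u) =
    \col_j \int[@lebesgue_measure R]_(t in `]0, tF[) ((F t)^T *m colU u t) j 0.
  by apply/colP => j; rewrite !mxE integral_FKcol.
pose y (j : 'I_nK) (t : measurableTypeR R) := ((F t)^T *m colU u t) j 0.
have FE t : (`]0, tF[%classic : set (measurableTypeR R)) t ->
    exp_operator AK (tF - t)
      (orthogonal_projection X (\sum_(i < m) u i t *: beta i)) =
    lincomb phi (\col_j y j t) %[ae mu].
  (* Transposing F_K gives exp((t_F - t) A_K) M_beta, and M_beta u(t) is the coordinate vector of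
     the sum of the u_i(t) beta_i. *)
  move=> _; rewrite (_ : \col_j _ =
      expmx ((tF - t) *: AKmx B phi) *m coords phi (\sum_(i < m) u i t *: beta i)); last first.
    apply/colP => j; rewrite mxE /y /FK trmx_mul trmxK trmx_expmx linearZ/= trmxK -mulmxA.
    congr ((_ *m _) j 0); apply/colP => k; rewrite !mxE dotL2_suml.
    by apply: eq_bigr => i _; rewrite !mxE dotL2Zl mulrC.
  apply: (exp_operator_lincomb phiP AKP.1); last exact: projection_ae.
  by move=> j k; rewrite AKP.2 ?mxE//; exact: (basis_mem_phi phiP).
have iy j : (@lebesgue_measure R).-integrable `]0, tF[ (EFin \o y j).
  have := integrable_sumR (measurable_0tF tF) (index_enum 'I_m)
    (fun i => integrable_time (FKcol j i) (u i)).
  apply: eq_integrable; first exact: measurable_0tF.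
  move=> t _ /=; congr EFin; rewrite /y mul_trFK.
  by apply: eq_bigr => i _; rewrite mxE.
exact: (bochner_integral_lincomb (measurable_0tF tF) (lebesgue_0tF_lty tF) phiP FE iy).
Qed.

End FK_columns.

(** * Completing the square for an abstract finite family of controls *)

Section gram.
Context {R : realType} (m n : nat) (tF : R) (f : 'I_n -> controls m tF).
Local Notation controls := (controls m tF).
Implicit Types (u h : controls) (x w : 'cV[R]_n).

Definition gram : 'M[R]_n := \matrix_(j, k) dotU (f j) (f k).
(** With [synthesis], the adjoint pair of frame theory; analysis after synthesis is the Gram
    matrix. *)
Definition analysis u : 'cV[R]_n := \col_j dotU (f j) u.
Definition synthesis w : controls := \sum_j w j 0 *: f j.

Lemma dotU_synthesis w u : dotU (synthesis w) u = \sum_j w j 0 * analysis u j 0.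
Proof.
by rewrite dotU_suml; apply: eq_bigr => j _; rewrite dotUZl mxE.
Qed.

Lemma analysis_synthesis w : analysis (synthesis w) = gram *m w.
Proof.
apply/colP => j; rewrite !mxE dotUC dotU_synthesis; apply: eq_bigr => k _.
by rewrite !mxE mulrC dotUC.
Qed.

Lemma trmx_gram : gram^T = gram.
Proof. by apply/matrixP => j k; rewrite !mxE dotUC. Qed.

Lemma gram_form x :
  \sum_j x j 0 * (gram *m x) j 0 = dotU (synthesis x) (synthesis x).
Proof. by rewrite dotU_synthesis analysis_synthesis. Qed.

(** The quadratic form of the matrix at x is rho |x|^2 + ||[synthesis x]||^2, hence positive
    definite. The left kernel vector of a singular matrix becomes a right one by symmetry. *)
Lemma gram_unit (rho : R) : 0 < rho -> rho%:M + gram \in unitmx.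
Proof.
move=> rho0; rewrite unitmxE unitfE; apply/negP => /det0P[v vn0 vG].
have Gx : (rho%:M + gram) *m v^T = 0.
  by rewrite -[LHS]trmxK trmx_mul trmxK linearD/= tr_scalar_mx trmx_gram vG trmx0.
have : \sum_j v^T j 0 * ((rho%:M + gram) *m v^T) j 0 = 0.
  by rewrite Gx big1// => j _; rewrite [(0 : 'cV_n) _ _]mxE mulr0.
under eq_bigr do rewrite mulmxDl mul_scalar_mx [X in _ * X]mxE
  [X in _ * (X + _)]mxE mulrDr.
rewrite big_split/= gram_form => /eqP; rewrite paddr_eq0 ?dotU_ge0//; last first.
  by apply: sumr_ge0 => j _; rewrite mulrCA pmulr_rge0// -expr2 sqr_ge0.
case/andP => + _; rewrite psumr_eq0 => [/allP v0|j _]; last first.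
  by rewrite mulrCA pmulr_rge0// -expr2 sqr_ge0.
case/eqP: vn0; apply/rowP => j; rewrite [RHS]mxE.
have := v0 j; rewrite mem_index_enum => /(_ isT).
by rewrite !mxE mulrCA !mulf_eq0 (gt_eqF rho0) orbb => /eqP.
Qed.

(* A vector in the kernel of the Gram matrix synthesizes a null control, so it
   is orthogonal to every [analysis u]; hence [analysis u] is in the range. *)
Lemma gram_range u : exists w, gram *m w = analysis u.
Proof.
suff /submxP[D uD] : ((analysis u)^T <= gram)%MS.
  by exists D^T; rewrite -{1}trmx_gram -trmx_mul -uD trmxK.
rewrite submxE; apply/eqP/rowP => k; rewrite [RHS]mxE.
pose y := col k (cokermx gram).
have Gy : gram *m y = 0 by rewrite /y colE mulmxA mulmx_coker mul0mx.
have : dotU (synthesis y) u = 0.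
  apply: dotU_null; rewrite -gram_form Gy.
  by rewrite big1// => j _; rewrite [(0 : 'cV_n) _ _]mxE mulr0.
rewrite dotU_synthesis => yu; rewrite mxE -[RHS]yu; apply: eq_bigr => j _.
by rewrite [y _ _]mxE [(_^T) _ _]mxE mulrC.
Qed.

Variables (rho c0 : R) (theta : 'cV[R]_n) (la lb ua ub : controls).
Hypothesis rho_gt0 : 0 < rho.

(** The squared distance to the target expanded in an orthonormal basis: [theta] holds the target's
    coordinates and [c0] its full squared norm, including the part orthogonal to the basis. *)
Definition lagrangian u : R :=
  \sum_j analysis u j 0 ^+ 2 - 2 * (\sum_j analysis u j 0 * theta j 0) + c0
  + rho * dotU u u + 2 * dotU la (ua - u) + 2 * dotU lb (u - ub).

Definition lagrangian_weight : 'cV[R]_n :=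
  invmx (rho%:M + gram) *m (theta - rho^-1 *: analysis (la - lb)).

Definition lagrangian_min : controls :=
  synthesis lagrangian_weight + rho^-1 *: (la - lb).

Local Notation uc := lagrangian_min.
Local Notation w := lagrangian_weight.

Lemma analysisD u h j : analysis (u + h) j 0 = analysis u j 0 + analysis h j 0.
Proof. by rewrite !mxE dotUDr. Qed.

(** The left side is half the directional derivative at [uc] along [h]. The multiplier terms cancel
    against rho times the second summand of [uc]; the remaining coefficient of <f_j, h> vanishes by
    the linear system [wE] defining the weight. *)
Lemma lagrangian_min_stationary h :
  \sum_j analysis uc j 0 * analysis h j 0 - \sum_j analysis h j 0 * theta j 0
  + rho * dotU uc h - dotU la h + dotU lb h = 0.
Proof.
have wE : rho *: w + gram *m w = theta - rho^-1 *: analysis (la - lb).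
  rewrite -mul_scalar_mx -mulmxDl /w mulmxA mulmxV ?mul1mx//.
  exact: gram_unit.
have -> : rho * dotU uc h = \sum_j rho * w j 0 * analysis h j 0 + (dotU la h - dotU lb h).
  rewrite dotUDl dotU_synthesis dotUZl dotUBl mulrDr mulrA divff ?gt_eqF// mul1r.
  by rewrite mulr_sumr; congr (_ + _); apply: eq_bigr => j _; rewrite mulrA.
suff : \sum_j analysis uc j 0 * analysis h j 0 - \sum_j analysis h j 0 * theta j 0
    + \sum_j rho * w j 0 * analysis h j 0 = 0 by lra.
rewrite -sumrB -big_split big1//= => j _.
have ucj : analysis uc j 0 = (gram *m w) j 0 + rho^-1 * analysis (la - lb) j 0.
  rewrite /lagrangian_min analysisD analysis_synthesis; congr (_ + _).
  by rewrite !mxE dotUC dotUZl dotUC.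
have DE (x y : 'cV[R]_n) : (x + y) j 0 = x j 0 + y j 0 by rewrite mxE.
have ZE k (x : 'cV[R]_n) : (k *: x) j 0 = k * x j 0 by rewrite mxE.
have := congr1 (fun z : 'cV[R]_n => z j 0) wE => /=.
rewrite -scaleNr !DE !ZE mulNr ucj => wj.
have -> : theta j 0 = rho * w j 0 + (gram *m w) j 0 + rho^-1 * analysis (la - lb) j 0.
  by rewrite wj subrK.
ring.
Qed.

(** The functional is quadratic, so its second-order expansion at [uc] is exact; the linear term is
    twice the expression just shown to vanish. *)
Lemma lagrangian_minE u :
  lagrangian u = lagrangian uc + \sum_j analysis (u - uc) j 0 ^+ 2
                 + rho * dotU (u - uc) (u - uc).
Proof.
rewrite -{1}(subrKC uc u); move: (u - uc) => h.
have := lagrangian_min_stationary h.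
rewrite /lagrangian; move: uc => v.
have -> : dotU la (ua - (v + h)) = dotU la (ua - v) - dotU la h.
  by rewrite -dotUBr opprD addrA.
have -> : dotU lb (v + h - ub) = dotU lb (v - ub) + dotU lb h.
  by rewrite -dotUDr addrAC.
have -> : dotU (v + h) (v + h) = dotU v v + 2 * dotU v h + dotU h h.
  rewrite !dotUDl !dotUDr [dotU h v]dotUC; ring.
have -> : \sum_j analysis (v + h) j 0 ^+ 2 = \sum_j analysis v j 0 ^+ 2
    + 2 * (\sum_j analysis v j 0 * analysis h j 0) + \sum_j analysis h j 0 ^+ 2.
  rewrite mulr_sumr -!big_split; apply: eq_bigr => j _ /=.
  rewrite analysisD; ring.
have -> : \sum_j analysis (v + h) j 0 * theta j 0 =
    \sum_j analysis v j 0 * theta j 0 + \sum_j analysis h j 0 * theta j 0.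
  by rewrite -big_split; apply: eq_bigr => j _; rewrite analysisD mulrDl.
lra.
Qed.

End gram.

Theorem proposition5p3 (R : realType) (d : nat) (Omega : set 'rV[R]_d)
    (oOmega : open Omega) (bOmega : bounded_set Omega)
    (cOmega : connected Omega)
    (tF : R) (tF_gt0 : 0 < tF) (m : nat) (m_gt0 : (0 < m)%N)
    (a : 'I_d -> 'I_d -> Linf (lebesgue_on oOmega))
    (b : 'I_d -> Linf (lebesgue_on oOmega))
    (c : Linf (lebesgue_on oOmega))
    (a_sym : forall i j, a i j = a j i %[ae lebesgue_on oOmega])
    (B_garding : garding (bform a b c))
    (SA : R -> L2 (lebesgue_on oOmega) -> L2 (lebesgue_on oOmega))
    (SA_semigroup : generates (form_operator (bform a b c)) SA)
    (betaS : 'I_m -> L2 (lebesgue_on oOmega))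
    (fS : L2 (lebesgue_cylinder oOmega tF))
    (g theta_r : L2 (lebesgue_on oOmega))
    (rho : R) (rho_gt0 : 0 < rho) (mu : 'I_m -> R) (mu_gt0 : forall i, 0 < mu i)
    (nK : nat) (XK : set (L2 (lebesgue_on oOmega)))
    (XK_H10 : XK `<=` H10 oOmega) (phi : 'I_nK -> L2 (lebesgue_on oOmega))
    (phi_basis : orthonormal_basis_of XK phi)
    (AK : L2 (lebesgue_on oOmega) -> L2 (lebesgue_on oOmega))
    (AK_galerkin : galerkin_operator (bform a b c) XK AK) :
  let theta_ro := theta_r - mild_solution SA fS g tF in
  let J (u : controls m tF) :=
    normL2 (lebesgue_on oOmega) (TK betaS XK AK u - theta_ro) ^+ 2
    + rho * sqnormU u in
  let ub : controls m tF := cstU tF mu in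
  let ua : controls m tF := - ub in
  let Lag (u la lb : controls m tF) :=
    J u + 2 * dotU la (ua - u) + 2 * dotU lb (u - ub) in
  let F := FK tF (bform a b c) betaS phi in
  let G := GK tF (bform a b c) betaS phi in
  let theta_ro_bar : 'cV[R]_nK :=
    \col_k dotL2 (lebesgue_on oOmega) (phi k) theta_ro in
  let uK (t : R) : 'cV[R]_m := F t *m invmx (rho%:M + G) *m theta_ro_bar in
  forall la lb : controls m tF,
  let xi := xiK (bform a b c) betaS phi la lb in
  exists uc : controls m tF,
    [/\ forall u, Lag uc la lb <= Lag u la lb,
        forall u', (forall u, Lag u' la lb <= Lag u la lb) ->
          forall i, u' i = uc i %[ae lebesgue_time tF],
        exists alpha : 'cV[R]_nK, G *m alpha = xi &
        forall alpha : 'cV[R]_nK, G *m alpha = xi ->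
          {ae lebesgue_time tF, forall t : R,
             colU uc t = uK t
               - F t *m (rho^-1%:M - invmx (rho%:M + G)) *m alpha
               + rho^-1 *: (colU la t - colU lb t)}].
Proof.
move=> theta_ro; move: theta_ro => theta_ro J ub ua Lag F G theta_ro_bar uK la lb xi.
pose f := FKcol tF (bform a b c) betaS phi.
have GE : G = gram f by apply/matrixP => j k; rewrite GKE mxE.
have xiE : xi = analysis f (la - lb) by apply/colP => j; rewrite xiKE mxE.
pose c0 := dotL2 (lebesgue_on oOmega) theta_ro theta_ro.
have LagE u : Lag u la lb = lagrangian f rho c0 theta_ro_bar la lb ua ub u.
  rewrite /Lag /J /lagrangian sqnormUE; congr (_ + _ + _ + _).
  set v := \col_j dotU (f j) u.
  have -> : normL2 (lebesgue_on oOmega) (TK betaS XK AK u - theta_ro) =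
            normL2 (lebesgue_on oOmega) (lincomb phi v - theta_ro).
    apply: normL2_ae; apply/ae_eqL2P => h; rewrite !dotL2Bl.
    by rewrite (dotL2_ae _ (TK_lincomb _ phi_basis AK_galerkin u)).
  rewrite normL2_sqr dotL2Bl !dotL2Br (dot_lincombs phi_basis).
  rewrite [dotL2 _ theta_ro (lincomb _ _)]dotL2C dot_lincomb.
  have -> : \sum_j v j 0 * v j 0 = \sum_j analysis f u j 0 ^+ 2.
    by apply: eq_bigr => j _; rewrite expr2.
  have -> : \sum_j v j 0 * dotL2 (lebesgue_on oOmega) (phi j) theta_ro =
            \sum_j analysis f u j 0 * theta_ro_bar j 0.
    by apply: eq_bigr => j _; rewrite !mxE.
  rewrite /c0; lra.
pose uc := lagrangian_min f rho theta_ro_bar la lb.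
have LagD u : Lag u la lb = Lag uc la lb + \sum_j analysis f (u - uc) j 0 ^+ 2
    + rho * dotU (u - uc) (u - uc).
  by rewrite !LagE lagrangian_minE.
have sq_ge0 u : 0 <= \sum_j analysis f (u - uc) j 0 ^+ 2.
  by apply: sumr_ge0 => j _; exact: sqr_ge0.
exists uc; split.
- move=> u; rewrite [leRHS]LagD -addrA lerDl addr_ge0//.
  by rewrite mulr_ge0 ?dotU_ge0// ltW.
(* Comparing [u'] with [uc] leaves two nonnegative excess terms whose sum is at most 0, so u' - u_c
   is null in each component. *)
- move=> u' /(_ uc); rewrite LagD => le_u' i.
  have /dotU_eq0 u0 : dotU (u' - uc) (u' - uc) = 0.
    apply/eqP; rewrite eq_le dotU_ge0 andbT -(pmulr_rle0 _ rho_gt0).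
    by have := sq_ge0 u'; lra.
  apply/ae_eqL2P => h; apply/eqP; rewrite -subr_eq0 -dotL2Bl; apply/eqP.
  by apply: dotL2_null; have := u0 i; rewrite !ffunE.
- by rewrite xiE GE; exact: gram_range.
(* For this representative [uc] the formula holds at every [t]. *)
move=> alpha Galpha; apply: aeW => t.
have Gu : rho%:M + G \in unitmx by rewrite GE; exact: gram_unit.
(* Checked after multiplying by rho I + G: the [alpha] term becomes rho^-1 G alpha = rho^-1 xi,
   whichever solution [alpha] is taken. *)
have wE : lagrangian_weight f rho theta_ro_bar la lb =
    invmx (rho%:M + G) *m theta_ro_bar
    - (rho^-1%:M - invmx (rho%:M + G)) *m alpha.
  rewrite /lagrangian_weight -xiE -GE -Galpha mulmxBr; congr (_ - _).
  apply: (can_inj (mulKmx Gu)); rewrite mulKVmx//.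
  rewrite mulmxA mulmxBr mulmxV// mul_mx_scalar mulmxBl mul1mx.
  rewrite -scalemxAl mulmxDl mul_scalar_mx scalerDr scalerA mulVf ?gt_eqF//.
  by rewrite scale1r addrAC subrr add0r.
have -> : uK t - F t *m (rho^-1%:M - invmx (rho%:M + G)) *m alpha =
    F t *m lagrangian_weight f rho theta_ro_bar la lb.
  by rewrite wE [RHS]mulmxBr !mulmxA.
have DE (x y : 'cV[R]_m) i : (x + y) i 0 = x i 0 + y i 0 by rewrite mxE.
have ZE k (x : 'cV[R]_m) i : (k *: x) i 0 = k * x i 0 by rewrite mxE.
have colE (u : controls m tF) i : colU u t i 0 = u i t by rewrite mxE.
apply/colP => i; rewrite -[- colU lb t]scaleN1r DE ZE DE ZE !colE mulN1r.
rewrite /uc /lagrangian_min !ffunE; congr (_ + _).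
rewrite mxE /synthesis sum_ffunE.
set w := lagrangian_weight _ _ _ _ _.
have sumE (r : seq 'I_nK) : (\sum_(j <- r) (w j 0 *: f j) i) t =
    \sum_(j <- r) F t i j * w j 0.
  elim: r => [|j r ih]; first by rewrite !big_nil.
  rewrite !big_cons -ih; congr (_ + _).
  by rewrite ffunE /= mulrC -FKcolE.
exact: sumE.
Qed.
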